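(* Let $N\ge3$ and suppose the Convexity Assumption, the Partial Strong Convexity Assumption and the Lipschitz Assumption (see context) hold. Let $(\bar{\mathbf x},\bar{\mathbf y})$ be the output of the SEG-ADMM algorithm after $T\ge1$ iterations, with $H_i\succeq(L_{\mathbf x}+L_{\mathbf y})I$ for $i=1,\dots,N$, $G\succeq L_{\mathbf y}I$ (all positive definite), and $$\gamma=\frac1{N(N-1)}\min\Big\{\frac{\mu_2}{\|A_2\|^2},\dots,\frac{\mu_N}{\|A_N\|^2}\Big\}.$$ Then, with $H=\mathrm{Diag}(H_1,\dots,H_N)$, for every $\rho>0$, $$\max_{\mathbf y\in\mathcal Y}\Phi(\bar{\mathbf x},\mathbf y)-\min_{\mathbf x\in\mathcal X,\,A\mathbf x=a}\Phi(\mathbf x,\bar{\mathbf y})+\rho\|A\bar{\mathbf x}-a\|\le\mathcal O\left(\frac{N^2\rho^2/\gamma+\|G\|D_{\mathcal Y}^2+\|H\|D_{\mathcal X}^2+\gamma\sum_{j=2}^N(2N+j)(j-1)\|A_j\|^2D_{\mathcal X_j}^2}{T}\right),$$ where $\mathcal O$ hides an absolute constant. Consequently it takes $T=\mathcal O(\epsilon^{-1})$ iterations to reach an $\epsilon$-saddle point; that is, there is a constant $C$ independent of $\epsilon$ (depending only on the problem data, $H$, $G$) such that for every $\epsilon\in(0,1]$ some $T\le C\epsilon^{-1}$ makes the output an $\epsilon$-saddle point.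
   Context: **Problem.** $\min_{\mathbf x\in\mathcal X}\max_{\mathbf y\in\mathcal Y}\Phi(\mathbf x,\mathbf y):=\sum_{i=1}^N h_i(x_i,\mathbf y)+\Psi(\mathbf x,\mathbf y)$ subject to $A\mathbf x=a$, where $\mathbf x=(x_1,\dots,x_N)$, $\mathcal X=\mathcal X_1\times\cdots\times\mathcal X_N$, the sets $\mathcal X_i\subset\mathbb R^{d_i}$ and $\mathcal Y\subset\mathbb R^{d}$ are compact and convex, $A=[A_1,\dots,A_N]$ with $A_i\in\mathbb R^{n\times d_i}$ ($A_i\ne0$ for $i\ge2$), $a\in\mathbb R^n$, so $A\mathbf x=\sum_iA_ix_i$. $D_{\mathcal X_i}$ and $D_{\mathcal Y}$ are the diameters of $\mathcal X_i$ and $\mathcal Y$, and $D_{\mathcal X}=\sqrt{\sum_iD_{\mathcal X_i}^2}$. **Slater's condition** (standing): there is $(\hat{\mathbf x},\hat{\mathbf y})\in\mathrm{int}(\mathcal X)\times\mathrm{int}(\mathcal Y)$ with $A\hat{\mathbf x}=a$. **Notation.** $\|\cdot\|$ is the Euclidean norm of vectors and the spectral norm of matrices; $\|v\|_M^2=v^\top Mv$ for symmetric $M$; $\succ,\succeq$ denote the Loewner order on symmetric matrices. **Convexity Assumption.** For every $\mathbf x\in\mathcal X$, $\Phi(\mathbf x,\cdot)$ is concave and upper semicontinuous on $\mathcal Y$. For every $\mathbf y\in\mathcal Y$ and every $i$, $h_i(\cdot,\mathbf y)$ is convex and lower semicontinuous on $\mathcal X_i$. $\Phi$ is bounded on $\mathcal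 X\times\mathcal Y$. For every $\mathbf y\in\mathcal Y$, $\Psi(\cdot,\mathbf y)$ is smooth and convex on $\mathcal X$, and $\|\nabla_{\mathbf x}\Psi(\mathbf x,\mathbf y)-\nabla_{\mathbf x}\Psi(\mathbf x',\mathbf y)\|\le L_{\mathbf x}\|\mathbf x-\mathbf x'\|$ for all $\mathbf x,\mathbf x'\in\mathcal X$, $\mathbf y\in\mathcal Y$. **Partial Strong Convexity Assumption.** For $i=2,\dots,N$ and every $\mathbf y\in\mathcal Y$, $h_i(\cdot,\mathbf y)$ is $\mu_i$-strongly convex on $\mathcal X_i$ ($\mu_i>0$). **Lipschitz Assumption.** $\Phi(\mathbf x,\cdot)$ is differentiable and $\|\nabla_{\mathbf y}\Phi(\mathbf x,\mathbf y)-\nabla_{\mathbf y}\Phi(\mathbf x',\mathbf y')\|\le L_{\mathbf y}\sqrt{\|\mathbf x-\mathbf x'\|^2+\|\mathbf y-\mathbf y'\|^2}$ for all $\mathbf x,\mathbf x'\in\mathcal X$, $\mathbf y,\mathbf y'\in\mathcal Y$. **Linearized augmented Lagrangian.** $\mathcal L_\gamma(\mathbf x,\lambda;\tilde{\mathbf x},\tilde{\mathbf y})=\sum_{i=1}^Nh_i(x_i,\tilde{\mathbf y})+\langle\nabla_{\mathbf x}\Psi(\tilde{\mathbf x},\tilde{\mathbf y}),\mathbf x-\tilde{\mathbf x}\rangle-\langle\lambda,A\mathbf x-a\rangle+\frac\gamma2\|A\mathbf x-a\|^2$. **Prox-ADMM step.** Given $\mathbf x\in\mathcal X$, $\lambda\in\mathbb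 R^n$, $\mathbf y\in\mathcal Y$, $\gamma>0$, $H_i\succ0$, the output $(\mathbf x^+,\lambda^+)=\texttt{Prox-ADMM}(\mathbf x,\lambda;\mathbf y;\gamma,\{H_i\})$ is defined by: for $i=1,\dots,N$ successively, $$x_i^+=\arg\min_{w_i\in\mathcal X_i}\mathcal L_\gamma\big((x_1^+,\dots,x_{i-1}^+,w_i,x_{i+1},\dots,x_N),\lambda;\mathbf x,\mathbf y\big)+\tfrac12\|w_i-x_i\|_{H_i}^2,$$ and then $\lambda^+=\lambda-\gamma(A\mathbf x^+-a)$. **SEG-ADMM algorithm.** Start from $\mathbf x^0\in\mathcal X$, $\mathbf y^0\in\mathcal Y$, $\lambda^0=0$, with $\gamma>0$, $G\succ0$, $H_i\succ0$. For $k=0,1,\dots$: (1) $\hat{\mathbf y}^{k+1}=\arg\min_{\mathbf y\in\mathcal Y}\frac12\|\mathbf y-[\mathbf y^k+G^{-1}\nabla_{\mathbf y}\Phi(\mathbf x^k,\mathbf y^k)]\|_G^2$; (2) $(\mathbf x^{k+1},\lambda^{k+1})=\texttt{Prox-ADMM}(\mathbf x^k,\lambda^k;\hat{\mathbf y}^{k+1};\gamma,\{H_i\})$; (3) $\mathbf y^{k+1}=\arg\min_{\mathbf y\in\mathcal Y}\frac12\|\mathbf y-[\mathbf y^k+G^{-1}\nabla_{\mathbf y}\Phi(\mathbf x^{k+1},\hat{\mathbf y}^{k+1})]\|_G^2$. The output after $T$ iterations is $\bar{\mathbf x}=\frac1T\sum_{k=1}^T\mathbf x^k$, $\bar{\mathbf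 y}=\frac1T\sum_{k=1}^{T}\hat{\mathbf y}^k$. **$\epsilon$-saddle point.** $(\bar{\mathbf x},\bar{\mathbf y})\in\mathcal X\times\mathcal Y$ is an $\epsilon$-saddle point if $\max_{\mathbf y\in\mathcal Y}\Phi(\bar{\mathbf x},\mathbf y)-\min_{\mathbf x\in\mathcal X,A\mathbf x=a}\Phi(\mathbf x,\bar{\mathbf y})\in[-\epsilon,\epsilon]$ and $\|A\bar{\mathbf x}-a\|\le\epsilon$. *)

(* Defs.v *)
From HB Require Import structures.
From mathcomp Require Import all_boot all_order all_algebra.
From mathcomp Require Import all_classical all_reals all_analysis.

Set Implicit Arguments.
Unset Strict Implicit.
Unset Printing Implicit Defensive.

Import Order.TTheory GRing.Theory Num.Theory.
Import numFieldNormedType.Exports.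

Local Open Scope classical_set_scope.
Local Open Scope ring_scope.

Section Euclidean.
Variable R : realType.

Definition dotv n (u v : 'cV[R]_n) : R := \sum_i u i 0 * v i 0.

(* The norm `|_| that MathComp-Analysis puts on matrices is the max norm; it
   induces the same topology as [enorm] but is not the Euclidean norm. *)
Definition enorm n (v : 'cV[R]_n) : R := Num.sqrt (dotv v v).

Definition spectral_norm m n (M : 'M[R]_(m, n)) : R :=
  sup [set enorm (M *m v) | v in [set v : 'cV[R]_n | enorm v <= 1]].

Definition wnorm2 n (M : 'M[R]_n) (v : 'cV[R]_n) : R := dotv v (M *m v).

Definition posdef n (M : 'M[R]_n) : Prop :=
  M^T = M /\ forall v, v != 0 -> 0 < wnorm2 M v.

Definition possemidef n (M : 'M[R]_n) : Prop :=
  M^T = M /\ forall v, 0 <= wnorm2 M v.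

Definition loewner_ge n (M M' : 'M[R]_n) : Prop := possemidef (M - M').

Definition diam n (S : set 'cV[R]_n) : R :=
  sup [set enorm (u - v) | u in S & v in S].

Definition is_max (S : set R) (m : R) : Prop := S m /\ ubound S m.
Definition is_min (S : set R) (m : R) : Prop := S m /\ lbound S m.

Definition is_argmin (T : Type) (S : set T) (f : T -> R) (x : T) : Prop :=
  S x /\ forall w, S w -> f x <= f w.

Section OnSet.
Variables (n : nat) (S : set 'cV[R]_n) (f : 'cV[R]_n -> R).

(* All regularity notions are relative to [S]: the values of [f] outside [S]
   are irrelevant (at boundary points limits are taken within [S]). *)
Definition lsc_on : Prop :=
  lower_semicontinuous (fun z : subspace S => (f z)%:E).

Definition strongly_convex_on (mu : R) : Prop :=
  forall x y t, S x -> S y -> 0 <= t <= 1 ->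
    f (t *: x + (1 - t) *: y) <=
      t * f x + (1 - t) * f y - mu / 2 * t * (1 - t) * enorm (x - y) ^+ 2.

Definition is_grad_on (x g : 'cV[R]_n) : Prop :=
  forall e, 0 < e -> \forall z \near within S (nbhs x),
    `|f z - f x - dotv g (z - x)| <= e * enorm (z - x).

Definition differentiable_on : Prop :=
  forall x, S x -> exists g, is_grad_on x g.

(* Well defined at the points of differentiability when [S] is convex with
   nonempty interior, since the gradient relative to [S] is then unique. *)
Definition grad_on (x : 'cV[R]_n) : 'cV[R]_n := xget 0 [set g | is_grad_on x g].

Definition convex_on : Prop := @convex_function R 'cV[R]_n S f.

End OnSet.

Definition usc_on n (S : set 'cV[R]_n) (f : 'cV[R]_n -> R) : Prop :=
  lsc_on S (fun z => - f z).

Definition concave_on n (S : set 'cV[R]_n) (f : 'cV[R]_n -> R) : Prop :=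
  convex_on S (fun z => - f z).

End Euclidean.

(* The blocks x_1, ..., x_N are indexed by 'I_N, so the ordinal [i] stands for
   the block number i + 1, and "i >= 2" reads [(0 < i)%N].  A block vector is
   the stacked column vector, and A = [A_1, ..., A_N] a block row matrix. *)
Record problem (R : realType) := Problem {
  nblk : nat;
  xdim : 'I_nblk -> nat;
  ydim : nat;
  nrow : nat;
  Xset : forall i, set 'cV[R]_(xdim i);
  Yset : set 'cV[R]_ydim;
  hfun : forall i, 'cV[R]_(xdim i) -> 'cV[R]_ydim -> R;
  Psi : 'cV[R]_(\sum_i xdim i)%N -> 'cV[R]_ydim -> R;
  Amat : 'M[R]_(nrow, (\sum_i xdim i)%N);
  avec : 'cV[R]_nrow
}.

Section Problem.
Variables (R : realType) (P : problem R).

Local Notation N := (nblk P).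
Local Notation xvec := 'cV[R]_(\sum_i @xdim R P i)%N.
Local Notation yvec := 'cV[R]_(ydim P).
Local Notation lvec := 'cV[R]_(nrow P).
Local Notation Y := (@Yset R P).
Local Notation A := (@Amat R P).
Local Notation a := (@avec R P).

Definition blk (x : xvec) (i : 'I_N) : 'cV[R]_(xdim i) := submxcol x i.
Definition Ablk (i : 'I_N) : 'M[R]_(nrow P, xdim i) := submxrow A i.

Definition Xprod : set xvec := [set x | forall i, Xset (blk x i)].

Definition feasible : set xvec := [set x | Xprod x /\ A *m x = a].

Definition Phi (x : xvec) (y : yvec) : R :=
  \sum_i hfun (blk x i) y + Psi x y.

Definition gradx_Psi (x : xvec) (y : yvec) : xvec :=
  grad_on Xprod (fun x' => Psi x' y) x.

Definition grady_Phi (x : xvec) (y : yvec) : yvec := grad_on Y (Phi x) y.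

Definition DX : R := Num.sqrt (\sum_i diam (@Xset R P i) ^+ 2).
Definition DY : R := diam Y.

Definition slater : Prop :=
  exists x y, [/\ (interior Xprod) x, (interior Y) y & A *m x = a].

Definition standing_assumptions : Prop :=
  [/\ forall i, compact (@Xset R P i) /\
        @convex_set R 'cV[R]_(xdim i) (@Xset R P i),
      compact Y /\ @convex_set R yvec Y,
      forall i : 'I_N, (0 < i)%N -> Ablk i != 0
    & slater].

Definition convexity_assumption (Lx : R) : Prop :=
  [/\ forall x, Xprod x -> concave_on Y (Phi x) /\ usc_on Y (Phi x),
      forall y, Y y -> forall i,
        convex_on (@Xset R P i) (fun w => hfun w y) /\
        lsc_on (@Xset R P i) (fun w => hfun w y),
      exists B, forall x y, Xprod x -> Y y -> `|Phi x y| <= B,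
      forall y, Y y ->
        differentiable_on Xprod (fun x => Psi x y) /\
        convex_on Xprod (fun x => Psi x y)
    & forall x x' y, Xprod x -> Xprod x' -> Y y ->
        enorm (gradx_Psi x y - gradx_Psi x' y) <= Lx * enorm (x - x')].

Definition partial_strong_convexity_assumption (mu : 'I_N -> R) : Prop :=
  forall i : 'I_N, (0 < i)%N -> 0 < mu i /\
    forall y, Y y ->
      strongly_convex_on (@Xset R P i) (fun w => hfun w y) (mu i).

Definition lipschitz_assumption (Ly : R) : Prop :=
  (forall x, Xprod x -> differentiable_on Y (Phi x)) /\
  (forall x x' y y', Xprod x -> Xprod x' -> Y y -> Y y' ->
     enorm (grady_Phi x y - grady_Phi x' y') <=
       Ly * Num.sqrt (enorm (x - x') ^+ 2 + enorm (y - y') ^+ 2)).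

Definition lin_aug_lagrangian (gamma : R) (x : xvec) (lam : lvec)
    (xt : xvec) (yt : yvec) : R :=
  \sum_i hfun (blk x i) yt + dotv (gradx_Psi xt yt) (x - xt)
  - dotv lam (A *m x - a) + gamma / 2 * enorm (A *m x - a) ^+ 2.

(* (x_1^+, ..., x_{i-1}^+, w, x_{i+1}, ..., x_N) *)
Definition gauss_seidel_point (xp x : xvec) (i : 'I_N) (w : 'cV[R]_(xdim i)) :
    xvec :=
  \mxcol_j eqtype.dfwith (fun k : 'I_N => if (k < i)%N then blk xp k else blk x k) w j.

Definition prox_admm (x : xvec) (lam : lvec) (y : yvec) (gamma : R)
    (H : forall i : 'I_N, 'M[R]_(xdim i)) (xp : xvec) (lamp : lvec) : Prop :=
  (forall i, is_argmin (@Xset R P i)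
     (fun w => lin_aug_lagrangian gamma (gauss_seidel_point xp x w) lam x y
               + 1 / 2 * wnorm2 (H i) (w - blk x i))
     (blk xp i)) /\
  lamp = lam - gamma *: (A *m xp - a).

Definition ystep (G : 'M[R]_(ydim P)) (y g yp : yvec) : Prop :=
  is_argmin Y (fun z => 1 / 2 * wnorm2 G (z - (y + invmx G *m g))) yp.

Definition seg_admm (gamma : R) (G : 'M[R]_(ydim P))
    (H : forall i : 'I_N, 'M[R]_(xdim i))
    (x : nat -> xvec) (y yh : nat -> yvec) (lam : nat -> lvec) : Prop :=
  [/\ Xprod (x 0%N), Y (y 0%N), lam 0%N = 0 &
      forall k,
        [/\ ystep G (y k) (grady_Phi (x k) (y k)) (yh k.+1),
            prox_admm (x k) (lam k) (yh k.+1) gamma H (x k.+1) (lam k.+1)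
          & ystep G (y k) (grady_Phi (x k.+1) (yh k.+1)) (y k.+1)]].

Definition ergodic n (u : nat -> 'cV[R]_n) (T : nat) : 'cV[R]_n :=
  T%:R^-1 *: \sum_(1 <= k < T.+1) u k.

Definition seg_gamma (mu : 'I_N -> R) (gamma : R) : Prop :=
  exists2 m, is_min [set mu i / spectral_norm (Ablk i) ^+ 2
                      | i in [set i : 'I_N | (0 < i)%N]] m
    & gamma = 1 / (N%:R * (N%:R - 1)) * m.

Definition is_gap (x : xvec) (y : yvec) (g : R) : Prop :=
  exists M m, [/\ is_max [set Phi x y' | y' in Y] M,
                  is_min [set Phi x' y | x' in feasible] m
                & g = M - m].

Definition eps_saddle (eps : R) (x : xvec) (y : yvec) : Prop :=
  [/\ Xprod x, Y y,
      exists2 g, is_gap x y g & - eps <= g <= eps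
    & enorm (A *m x - a) <= eps].

(* In the last sum the paper's index is j + 1. *)
Definition rate_numerator (gamma rho : R) (G : 'M[R]_(ydim P))
    (H : forall i : 'I_N, 'M[R]_(xdim i)) : R :=
  N%:R ^+ 2 * rho ^+ 2 / gamma
  + spectral_norm G * DY ^+ 2
  + spectral_norm (\mxdiag_i H i) * DX ^+ 2
  + gamma * \sum_(j < N | (0 < j)%N)
      (2 * N%:R + j.+1%:R) * j%:R * spectral_norm (Ablk j) ^+ 2
        * diam (@Xset R P j) ^+ 2.

End Problem.

(* Main.v *)
Require Import Defs.
From HB Require Import structures.
From mathcomp Require Import all_boot all_order all_algebra.
From mathcomp Require Import all_classical all_reals all_analysis.
From mathcomp Require Import ring lra.

Set Implicit Arguments.
Unset Strict Implicit.
Unset Printing Implicit Defensive.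

Import Order.TTheory GRing.Theory Num.Theory.
Import numFieldNormedType.Exports.

Local Open Scope classical_set_scope.
Local Open Scope ring_scope.

(** The rate holds with absolute constant 1.  Write one iteration as
    (x, lam, y) -> (x+, lam+, y+), with intermediate dual point yh.

    - Optimality of each block minimisation, tested against a feasible [u], gives a
      variational inequality in which block [i] sees the current residual minus the
      not yet performed updates A_j (x+_j - x_j), j > i
      ([prox_block_variational]).  Summing over the blocks, with convexity and the
      descent lemma for Psi ([convex_descent]), leaves one term of indefinite sign:
      the coupling of these updates with the errors A_i (x+_i - u_i).
    - With p_j = A_j (x_j - u_j) and q_j = A_j (x+_j - u_j), the sum of all q_j is
      the residual, since [u] is feasible.  This trades the contribution of the
      first block, which is not strongly convex, for the residual; half the
      squared residual is supplied by the multiplier update.  What remains is a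
      telescoping sum of squares plus products of p_j, q_j over distinct blocks
      other than the first ([gauss_seidel_identity], [gauss_seidel_coupling]), and
      for the prescribed gamma the strong convexity of those blocks absorbs it
      ([block_absorption]).
    - The two projections onto Y form an extragradient step
      ([extragradient_step]); its error (Ly / 2) |x+ - x|^2 is absorbed, together
      with the Lx / 2 of the descent lemma, by H_i >= (Lx + Ly) I.

    Hence Phi(x+, v) - Phi(u, yh) - <lt, A x+ - a> is at most the decrease of a
    Lyapunov function ([potential], [seg_admm_step]), for every v in Y, feasible u
    and test multiplier lt.  Averaging with Jensen's inequality, and taking for v
    and u the extremal points of the gap and for lt the vector of length rho
    opposite to the residual of the average, yields the rate.

    For the complexity bound, Slater's condition gives an exact penalty
    ([exact_penalty]): the gap is at least -L |A x - a| with L uniform in y.  The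
    rate with rho = L + 1 then bounds the residual, and both signs of the gap, by a
    multiple of 1 / T. *)

(** * Euclidean vectors and matrix norms *)

Section Euclid.
Variable R : realType.

Lemma dotvC n (u v : 'cV[R]_n) : dotv u v = dotv v u.
Proof. by apply: eq_bigr => i _; rewrite mulrC. Qed.

Lemma dotvDl n (u v w : 'cV[R]_n) : dotv (u + v) w = dotv u w + dotv v w.
Proof.
by rewrite /dotv -big_split; apply: eq_bigr => i _; rewrite mxE mulrDl.
Qed.

Lemma dotvZl n (c : R) (u v : 'cV[R]_n) : dotv (c *: u) v = c * dotv u v.
Proof.
by rewrite /dotv mulr_sumr; apply: eq_bigr => i _; rewrite mxE mulrA.
Qed.

Lemma dotvNl n (u v : 'cV[R]_n) : dotv (- u) v = - dotv u v.
Proof. by rewrite -scaleN1r dotvZl mulN1r. Qed.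

Lemma dotvDr n (w u v : 'cV[R]_n) : dotv w (u + v) = dotv w u + dotv w v.
Proof. by rewrite dotvC dotvDl !(dotvC w). Qed.

Lemma dotvZr n (c : R) (u v : 'cV[R]_n) : dotv u (c *: v) = c * dotv u v.
Proof. by rewrite dotvC dotvZl dotvC. Qed.

Lemma dotvNr n (u v : 'cV[R]_n) : dotv u (- v) = - dotv u v.
Proof. by rewrite dotvC dotvNl dotvC. Qed.

Definition dotvE := (dotvDl, dotvDr, dotvNl, dotvNr, dotvZl, dotvZr).

Lemma dotv0r n (u : 'cV[R]_n) : dotv u 0 = 0.
Proof. by rewrite /dotv big1// => i _; rewrite mxE mulr0. Qed.

Lemma dotv0l n (u : 'cV[R]_n) : dotv 0 u = 0.
Proof. by rewrite dotvC dotv0r. Qed.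

Lemma dotv_sumr n (I : Type) (r : seq I) (Q : pred I) (F : I -> 'cV[R]_n) w :
  dotv w (\sum_(i <- r | Q i) F i) = \sum_(i <- r | Q i) dotv w (F i).
Proof.
by elim/big_rec2 : _ => [|i s v _ <-]; rewrite ?dotv0r ?dotvDr.
Qed.

Lemma dotv_mx n (u v : 'cV[R]_n) : dotv u v = (u^T *m v) 0 0.
Proof. by rewrite mxE; apply: eq_bigr => i _; rewrite mxE. Qed.

Lemma dotv_trmx m n (M : 'M[R]_(m, n)) u v : dotv u (M *m v) = dotv (M^T *m u) v.
Proof. by rewrite !dotv_mx trmx_mul trmxK mulmxA. Qed.

Lemma dotv_ge0 n (v : 'cV[R]_n) : 0 <= dotv v v.
Proof. by apply: sumr_ge0 => i _; rewrite -expr2 sqr_ge0. Qed.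

Lemma enorm_sqr n (v : 'cV[R]_n) : enorm v ^+ 2 = dotv v v.
Proof. by rewrite sqr_sqrtr// dotv_ge0. Qed.

Lemma enorm_ge0 n (v : 'cV[R]_n) : 0 <= enorm v.
Proof. exact: sqrtr_ge0. Qed.

Lemma enorm0 n : enorm (0 : 'cV[R]_n) = 0.
Proof. by rewrite /enorm dotv0r sqrtr0. Qed.

Lemma enormZ n c (v : 'cV[R]_n) : enorm (c *: v) = `|c| * enorm v.
Proof.
by rewrite /enorm dotvZl dotvZr mulrA -expr2 sqrtrM ?sqr_ge0// sqrtr_sqr.
Qed.

Lemma enormN n (v : 'cV[R]_n) : enorm (- v) = enorm v.
Proof. by rewrite -scaleN1r enormZ normrN1 mul1r. Qed.

Lemma normr_coord n (v : 'cV[R]_n) i : `|v i 0| <= enorm v.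
Proof.
rewrite -(@ler_pXn2r _ 2) ?nnegrE ?enorm_ge0// enorm_sqr real_normK ?num_real//.
by rewrite /dotv (bigD1 i)//= expr2 lerDl sumr_ge0// => j _; rewrite -expr2 sqr_ge0.
Qed.

Lemma enorm_eq0 n (v : 'cV[R]_n) : enorm v = 0 -> v = 0.
Proof.
move=> v0; apply/colP => i; rewrite mxE; apply/normr0_eq0/le_anti.
by rewrite normr_ge0 andbT -v0 normr_coord.
Qed.

Lemma dotv_le_normM n (u v : 'cV[R]_n) : dotv u v <= enorm u * enorm v.
Proof.
have [/enorm_eq0 ->|u0] := eqVneq (enorm u) 0; first by rewrite dotv0l enorm0 mul0r.
have [/enorm_eq0 ->|v0] := eqVneq (enorm v) 0; first by rewrite dotv0r enorm0 mulr0.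
have up : 0 < enorm u by rewrite lt_neqAle eq_sym u0 enorm_ge0.
have vp : 0 < enorm v by rewrite lt_neqAle eq_sym v0 enorm_ge0.
have := dotv_ge0 (enorm v *: u - enorm u *: v).
rewrite !dotvE (dotvC v u) -!enorm_sqr => H.
have H2 : 0 <= (enorm u * enorm v) * (enorm u * enorm v - dotv u v) by nra.
by move: H2; rewrite pmulr_rge0 ?mulr_gt0// subr_ge0.
Qed.

Lemma dotv_ge_normM n (u v : 'cV[R]_n) : - (enorm u * enorm v) <= dotv u v.
Proof. by rewrite lerNl -dotvNl -(enormN u) dotv_le_normM. Qed.

Lemma dotv_le_sqr n (u v : 'cV[R]_n) :
  dotv u v <= enorm u ^+ 2 / 2 + enorm v ^+ 2 / 2.
Proof.
have := dotv_ge0 (u - v); rewrite !dotvE (dotvC v u) -!enorm_sqr => H; lra.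
Qed.

Lemma mulmx_enorm_bound m n (M : 'M[R]_(m, n)) :
  exists2 K, 0 <= K & forall v, enorm (M *m v) <= K * enorm v.
Proof.
exists (Num.sqrt (\sum_i dotv (row i M)^T (row i M)^T)); first exact: sqrtr_ge0.
move=> v; rewrite -(@ler_pXn2r _ 2) ?nnegrE ?mulr_ge0 ?enorm_ge0 ?sqrtr_ge0//.
have S0 : 0 <= \sum_i dotv (row i M)^T (row i M)^T.
  by apply: sumr_ge0 => i _; exact: dotv_ge0.
rewrite exprMn (sqr_sqrtr S0).
rewrite enorm_sqr mulr_suml ler_sum// => i _.
have -> : (M *m v) i 0 = dotv (row i M)^T v.
  by rewrite mxE; apply: eq_bigr => j _; rewrite !mxE.
rewrite -!enorm_sqr -exprMn -expr2 -[leLHS]real_normK ?num_real//.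
rewrite ler_pXn2r ?nnegrE ?mulr_ge0 ?enorm_ge0//.
by rewrite ler_norml dotv_le_normM dotv_ge_normM.
Qed.

Lemma spectral_normP m n (M : 'M[R]_(m, n)) v :
  enorm (M *m v) <= spectral_norm M * enorm v.
Proof.
have [/enorm_eq0 ->|v0] := eqVneq (enorm v) 0; first by rewrite mulmx0 !enorm0 mulr0.
have vp : 0 < enorm v by rewrite lt_neqAle eq_sym v0 enorm_ge0.
rewrite -ler_pdivrMr// mulrC.
have [K K0 MK] := mulmx_enorm_bound M.
apply: ub_le_sup.
  exists K => _ [u /= u1 <-]; rewrite (le_trans (MK u))// ler_piMr//.
exists ((enorm v)^-1 *: v) => /=.
  by rewrite enormZ ger0_norm ?invr_ge0 ?enorm_ge0// mulVf.
by rewrite -scalemxAr enormZ ger0_norm ?invr_ge0 ?enorm_ge0.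
Qed.

Lemma spectral_norm_ge0 m n (M : 'M[R]_(m, n)) : 0 <= spectral_norm M.
Proof.
have [K K0 MK] := mulmx_enorm_bound M.
apply: ub_le_sup; last by exists 0; rewrite /= ?mulmx0 ?enorm0.
by exists K => _ [u /= u1 <-]; rewrite (le_trans (MK u))// ler_piMr.
Qed.

Lemma spectral_norm_gt0 m n (M : 'M[R]_(m, n)) : M != 0 -> 0 < spectral_norm M.
Proof.
move=> M0; rewrite lt_neqAle spectral_norm_ge0 andbT; apply: contra M0 => /eqP s0.
apply/eqP/matrixP => i j; rewrite mxE.
have /enorm_eq0 Mj : enorm (M *m delta_mx j 0) = 0.
  apply/le_anti; rewrite enorm_ge0 andbT (le_trans (spectral_normP _ _))//.
  by rewrite -s0 mul0r.
have <- : col j M i 0 = M i j by rewrite mxE.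
by rewrite colE Mj mxE.
Qed.

Lemma wnorm2_le n (M : 'M[R]_n) v : wnorm2 M v <= spectral_norm M * enorm v ^+ 2.
Proof.
rewrite /wnorm2 (le_trans (dotv_le_normM _ _))// expr2 mulrCA.
by rewrite ler_wpM2l ?enorm_ge0 ?spectral_normP.
Qed.

Lemma wnorm2D n (M : 'M[R]_n) u v : M^T = M ->
  wnorm2 M (u + v) = wnorm2 M u + 2 * dotv (M *m u) v + wnorm2 M v.
Proof.
move=> Msym; rewrite /wnorm2 mulmxDr !dotvE.
have -> : dotv u (M *m v) = dotv (M *m u) v by rewrite dotv_trmx Msym.
by rewrite (dotvC v (M *m u)); ring.
Qed.

Lemma wnorm2Z n (M : 'M[R]_n) c v : wnorm2 M (c *: v) = c ^+ 2 * wnorm2 M v.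
Proof. by rewrite /wnorm2 -scalemxAr !dotvE; ring. Qed.

Lemma posdef_ge0 n (M : 'M[R]_n) v : posdef M -> 0 <= wnorm2 M v.
Proof.
move=> [_ Mp]; have [->|/Mp/ltW//] := eqVneq v 0.
by rewrite /wnorm2 dotv0l.
Qed.

Lemma posdef_unitmx n (M : 'M[R]_n) : posdef M -> M \in unitmx.
Proof.
move=> [Msym Mp]; rewrite -row_free_unit -kermx_eq0; apply/eqP/row_matrixP => i.
rewrite row0; apply/eqP; apply: contraT => k0.
have kM : row i (kermx M) *m M = 0 by rewrite -row_mul mulmx_ker row0.
suff : (row i (kermx M))^T != 0.
  move=> /Mp; rewrite /wnorm2 -[X in X *m _]Msym -trmx_mul kM.
  by rewrite trmx0 dotv0r ltxx.
by apply: contra k0 => /eqP k0; rewrite -[row _ _]trmxK k0 trmx0.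
Qed.

(** The three-point identity that makes proximal terms telescope. *)
Lemma wnorm2_three_point n (M : 'M[R]_n) (x y z : 'cV[R]_n) : M^T = M ->
  dotv (M *m (y - x)) (z - y) =
  1 / 2 * (wnorm2 M (z - x) - wnorm2 M (z - y) - wnorm2 M (y - x)).
Proof.
move=> Msym; have -> : z - x = (y - x) + (z - y) by rewrite [RHS]addrC subrKA.
by rewrite wnorm2D//; field.
Qed.

Lemma loewner_ge_scalar n (M : 'M[R]_n) c v :
  loewner_ge M c%:M -> c * enorm v ^+ 2 <= wnorm2 M v.
Proof.
move=> [_ /(_ v)]; rewrite /wnorm2 mulmxBl mul_scalar_mx !dotvE -enorm_sqr.
by rewrite subr_ge0.
Qed.

(** Neighbourhoods for the maximum norm contain Euclidean balls. *)
Lemma nbhs_enorm n (x : 'cV[R]_n) (U : set 'cV[R]_n) : nbhs x U ->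
  exists2 r, 0 < r & forall z, enorm (z - x) < r -> U z.
Proof.
move=> /nbhs_ballP[r /= r0 rU]; exists r => // z zr; apply: rU.
split => // i j; rewrite /ball /= ord1 distrC.
have -> : z i 0 - x i 0 = (z - x) i 0 by rewrite !mxE.
exact: le_lt_trans (normr_coord _ _) zr.
Qed.

Lemma diamP n (S : set 'cV[R]_n) u v :
  compact S -> S u -> S v -> enorm (u - v) <= diam S.
Proof.
move=> /compact_bounded[M [_ SM]] Su Sv.
have [B B0 {}SM] : exists2 B : R, 0 <= B & forall w, S w -> `|w| <= B.
  exists (`|M| + 1); first by rewrite addr_ge0.
  by move=> w Sw; apply: SM Sw; rewrite (le_lt_trans (ler_norm M)) ?ltrDl.
apply: ub_le_sup; last by exists u => //; exists v.
have BB0 : 0 <= B + B by rewrite addr_ge0.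
exists (Num.sqrt (n%:R * (B + B) ^+ 2)) => _ [a Sa [b Sb <-]].
rewrite ler_sqrt ?mulr_ge0 ?ler0n ?sqr_ge0//.
rewrite -[X in X%:R](card_ord n) mulr_natl -sumr_const ler_sum// => i _.
rewrite -expr2 -[leLHS]real_normK ?num_real//.
rewrite ler_pXn2r ?nnegrE//.
have abs w : S w -> `|w i 0| <= B.
  move=> /SM; apply: le_trans.
  rewrite [leRHS]mx_normrE.
  exact: (le_bigmax _ (fun k : 'I_n * 'I_1 => `|w k.1 k.2|) (i, 0)).
by rewrite !mxE (le_trans (ler_normB _ _))// lerD// abs.
Qed.

Lemma diam_ge0 n (S : set 'cV[R]_n) u : compact S -> S u -> 0 <= diam S.
Proof. by move=> cS Su; apply: le_trans (diamP cS Su Su); exact: enorm_ge0. Qed.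

End Euclid.

(** * Convex analysis relative to a set *)

Section ConvexAnalysis.
Variable R : realType.

Lemma ge0_of_harmonic (a b : R) :
  (forall m : nat, 0 <= a + m.+1%:R^-1 * b) -> 0 <= a.
Proof.
move=> H; rewrite leNgt; apply/negP => a0.
have := H (Num.truncn (`|b| / - a)); set m := Num.truncn _.
have bm : `|b| / - a < m.+1%:R by exact: truncnS_gt.
have m0 : 0 < m.+1%:R :> R by rewrite ltr0Sn.
rewrite ltr_pdivrMr ?oppr_gt0// in bm.
have -> : a + m.+1%:R^-1 * b = m.+1%:R^-1 * (m.+1%:R * a + b).
  by rewrite mulrDr mulKf// gt_eqF.
rewrite pmulr_rge0 ?invr_gt0//; have := ler_norm b; lra.
Qed.

Section OneSet.
Variables (n : nat) (S : set 'cV[R]_n).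
Hypothesis cS : @convex_set R 'cV[R]_n S.

Lemma convex_set_comb x y (t : R) : S x -> S y -> 0 <= t <= 1 ->
  S (t *: x + (1 - t) *: y).
Proof.
move=> Sx Sy t01.
pose t' : {i01 R} := Itv01 (proj1 (andP t01)) (proj2 (andP t01)).
by have /set_mem := cS t' (mem_set Sx) (mem_set Sy).
Qed.

Lemma convex_on_strongly f : convex_on S f -> strongly_convex_on S f 0.
Proof.
move=> cf x y t Sx Sy t01.
pose t' : {i01 R} := Itv01 (proj1 (andP t01)) (proj2 (andP t01)).
have := cf t' x y (mem_set Sx) (mem_set Sy).
by rewrite mul0r !mul0r subr0.
Qed.

Lemma convex_on_comb f x y t : convex_on S f -> S x -> S y -> 0 <= t <= 1 ->
  f (t *: x + (1 - t) *: y) <= t * f x + (1 - t) * f y.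
Proof.
by move=> /convex_on_strongly + Sx Sy t01 => /(_ x y t Sx Sy t01);
  rewrite !mul0r subr0.
Qed.

Lemma segmentE (x y : 'cV[R]_n) t : x + t *: (y - x) = t *: y + (1 - t) *: x.
Proof. by rewrite scalerBr scalerBl scale1r addrCA. Qed.

Lemma convex_set_segment x y t : S x -> S y -> 0 <= t <= 1 ->
  S (x + t *: (y - x)).
Proof. by move=> Sx Sy t01; rewrite segmentE; exact: convex_set_comb. Qed.

Lemma ergodicS (u : nat -> 'cV[R]_n) T : (0 < T)%N ->
  ergodic u T.+1 =
  (1 - T.+1%:R^-1) *: ergodic u T + (1 - (1 - T.+1%:R^-1)) *: u T.+1.
Proof.
move=> T0; rewrite /ergodic big_nat_recr//= scalerDr scalerA; congr (_ *: _ + _ *: _).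
- have t0 : T%:R != 0 :> R by rewrite pnatr_eq0 -lt0n.
  have t1 : T.+1%:R != 0 :> R by rewrite pnatr_eq0.
  by apply: (mulIf t1); rewrite mulVf// mulrAC mulrBl mul1r mulVf// -natr1 addrK divff.
- by rewrite subKr.
Qed.

Lemma invSn_itv T : 0 <= (1 - T.+1%:R^-1 : R) <= 1.
Proof.
by rewrite subr_ge0 invf_le1 ?ltr0Sn// ler1n/= gerBl invr_ge0 ler0n.
Qed.

Lemma ergodic_in (u : nat -> 'cV[R]_n) T : (0 < T)%N ->
  (forall k, S (u k.+1)) -> S (ergodic u T).
Proof.
case: T => // T _ Su; elim: T => [|T IH].
  by rewrite /ergodic big_nat1 invr1 scale1r.
by rewrite ergodicS//; apply: convex_set_comb => //; exact: invSn_itv.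
Qed.

(** Jensen's inequality for the running average. *)
Lemma convex_on_ergodic f (u : nat -> 'cV[R]_n) T : convex_on S f -> (0 < T)%N ->
  (forall k, S (u k.+1)) ->
  f (ergodic u T) <= T%:R^-1 * \sum_(1 <= k < T.+1) f (u k).
Proof.
move=> cf; case: T => // T _ Su; elim: T => [|T IH].
  by rewrite /ergodic !big_nat1 invr1 scale1r mul1r.
rewrite ergodicS//; set t : R := 1 - _.
have /andP[t0 t1] : 0 <= t <= 1 := invSn_itv T.+1.
have /le_trans : f (t *: ergodic u T.+1 + (1 - t) *: u T.+2) <=
   t * f (ergodic u T.+1) + (1 - t) * f (u T.+2).
  by apply: convex_on_comb => //; [exact: ergodic_in|rewrite t0].
apply; rewrite big_nat_recr//=.
have /(ler_wpM2l t0) IH' := IH.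
have tE : t * (T.+1%:R^-1) = T.+2%:R^-1.
  have a1 : T.+1%:R != 0 :> R by rewrite pnatr_eq0.
  have a2 : T.+2%:R != 0 :> R by rewrite pnatr_eq0.
  by apply: (mulIf a2); rewrite mulVf// /t mulrAC mulrBl mul1r
    mulVf// -natr1 addrK divff.
by rewrite mulrDr {2}/t subKr lerD2r -tE -mulrA.
Qed.

(** First-order optimality at a constrained minimiser of the sum of a strongly
    convex function and a function [q] that is quadratic along the segment to
    the test point. *)
Lemma argmin_variational f q mu xp w l k :
  strongly_convex_on S f mu -> is_argmin S (fun z => f z + q z) xp -> S w ->
  (forall t, q (xp + t *: (w - xp)) = q xp + t * l + t ^+ 2 * k) ->
  mu / 2 * enorm (w - xp) ^+ 2 <= f w - f xp + l.
Proof.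
move=> sf [Sxp minxp] Sw qE; rewrite -subr_ge0.
set D := enorm (w - xp) ^+ 2.
apply: (@ge0_of_harmonic _ (mu / 2 * D + k)) => m.
set t : R := m.+1%:R^-1.
have t0 : 0 < t by rewrite invr_gt0 ltr0Sn.
have t1 : t <= 1 by rewrite invf_le1 ?ltr0Sn// ler1n.
have t01 : 0 <= t <= 1 by rewrite ltW.
have := minxp _ (convex_set_segment Sxp Sw t01).
rewrite qE segmentE => H1.
have := sf w xp t Sw Sxp t01; rewrite -/D => H2.
have : 0 <= t * (f w - f xp + l - mu / 2 * D + t * (mu / 2 * D + k)) by nra.
by rewrite pmulr_rge0.
Qed.

Lemma grad_on_convex f x g u : convex_on S f -> is_grad_on S f x g ->
  S x -> S u -> dotv g (u - x) <= f u - f x.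
Proof.
move=> cf gf Sx Su; rewrite -subr_ge0.
apply: (@ge0_of_harmonic _ (enorm (u - x))) => m.
set e : R := m.+1%:R^-1.
have e0 : 0 < e by rewrite invr_gt0 ltr0Sn.
have [r r0 rP] := nbhs_enorm (gf e e0).
set D := enorm (u - x).
pose t : R := Num.min 1 (r / (D + 1) / 2).
have D0 : 0 <= D := enorm_ge0 _.
have t0 : 0 < t by rewrite lt_min ltr01 !divr_gt0// ltr_wpDl.
have t1 : t <= 1 by rewrite ge_min lexx.
have t01 : 0 <= t <= 1 by rewrite ltW.
have zE : x + t *: (u - x) - x = t *: (u - x) by rewrite addrC addKr.
have Sz := convex_set_segment Sx Su t01.
have tr : t * D < r.
  have : t <= r / (D + 1) / 2 by rewrite ge_min lexx orbT.
  rewrite -mulrA -invfM ler_pdivlMr; last by rewrite mulr_gt0// ltr_wpDl.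
  have := mulr_ge0 (ltW t0) D0; nra.
have := rP (x + t *: (u - x)); rewrite zE enormZ (ger0_norm (ltW t0)) => /(_ tr Sz).
rewrite ler_norml => /andP[H _]; rewrite dotvZr -/D in H.
have := convex_on_comb cf Su Sx t01; rewrite -segmentE => H2.
have : 0 <= t * (f u - f x - dotv g (u - x) + e * D) by nra.
by rewrite pmulr_rge0.
Qed.

(** The descent lemma; for a convex function it needs only the gradient
    inequality, applied between consecutive points of a fine subdivision. *)
Lemma convex_descent f (G : 'cV[R]_n -> 'cV[R]_n) L x y : convex_on S f ->
  (forall z, S z -> is_grad_on S f z (G z)) ->
  (forall z, S z -> enorm (G z - G x) <= L * enorm (z - x)) ->
  S x -> S y ->
  f y <= f x + dotv (G x) (y - x) + L / 2 * enorm (y - x) ^+ 2.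
Proof.
move=> cf gG LG Sx Sy; rewrite -subr_ge0.
set D := enorm (y - x).
apply: (@ge0_of_harmonic _ (L / 2 * D ^+ 2)) => m.
set h : R := m.+1%:R^-1.
have h0 : 0 < h by rewrite invr_gt0 ltr0Sn.
have step k : (k <= m.+1)%N ->
  f (x + (k%:R * h) *: (y - x)) <= f x + k%:R * h * dotv (G x) (y - x)
    + L / 2 * D ^+ 2 * (k%:R * (k%:R + 1)) * h ^+ 2.
  have t01 j : (j <= m.+1)%N -> 0 <= j%:R * h <= 1.
    by move=> jm; rewrite mulr_ge0 ?ler0n ?(ltW h0)//=
      ler_pdivrMr ?ltr0Sn// mul1r ler_nat.
  elim: k => [|k IH] km.
    by rewrite !mul0r scale0r addr0 addr0 mulr0 mul0r addr0.
  set z0 := x + (k%:R * h) *: (y - x); set z1 := x + _ *: _.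
  have Sz0 : S z0 by apply: convex_set_segment => //; apply: t01; exact: ltnW.
  have Sz1 : S z1 by apply: convex_set_segment => //; exact: t01.
  have := grad_on_convex cf (gG _ Sz1) Sz1 Sz0.
  have -> : z0 - z1 = - h *: (y - x).
    by rewrite /z0 /z1 opprD addrACA subrr add0r -scalerBl -natr1; congr (_ *: _); ring.
  rewrite dotvZr => H.
  have E : dotv (G z1) (y - x) = dotv (G x) (y - x) + dotv (G z1 - G x) (y - x).
    by rewrite dotvDl dotvNl; ring.
  have CS := dotv_le_normM (G z1 - G x) (y - x).
  have zx : z1 - x = (k.+1%:R * h) *: (y - x) by rewrite /z1 addrC addKr.
  have := LG _ Sz1; rewrite zx enormZ ger0_norm => [LG1|]; last first.
    by have /andP[] := t01 _ km.
  have D0 : 0 <= D := enorm_ge0 _.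
  have LG2 := ler_wpM2r D0 LG1.
  have {}IH := IH (ltnW km).
  rewrite -/D in LG1 LG2 CS.
  rewrite -natr1 in LG2 *.
  have LG3 : dotv (G z1 - G x) (y - x) <= L * D ^+ 2 * (k%:R + 1) * h.
    by apply: le_trans CS _; apply: le_trans LG2 _; rewrite -subr_ge0; nra.
  have {}LG3 := ler_wpM2l (ltW h0) LG3.
  rewrite E in H.
  apply: (@le_trans _ _ (f z0 + h * dotv (G x) (y - x)
    + h * dotv (G z1 - G x) (y - x))).
    lra.
  apply: le_trans (lerD (lerD IH (lexx _)) LG3) _.
  lra.
have := step m.+1 (leqnn _).
rewrite divff ?pnatr_eq0// scale1r addrC subrK mul1r => H.
have hE : m.+1%:R * (m.+1%:R + 1) * h ^+ 2 = 1 + h.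
  by rewrite /h; field.
rewrite -mulrA hE in H; lra.
Qed.

End OneSet.

End ConvexAnalysis.

(** * Semicontinuity and attainment of minima *)

Section Attainment.
Variable R : realType.

Lemma enorm_ball_nbhs n (x : 'cV[R]_n) (r : R) : 0 < r ->
  nbhs x [set z | enorm (z - x) < r].
Proof.
move=> r0; have [e e0 rE] : exists2 e : R, 0 < e & r = n.+1%:R * e.
  by exists (r / n.+1%:R); rewrite ?divr_gt0 ?ltr0Sn// mulrC divfK// pnatr_eq0.
apply/nbhs_ballP; exists e => // z [_ xz] /=.
have zx i : (z - x) i 0 ^+ 2 <= e ^+ 2.
  have := xz i 0; rewrite /ball /= distrC !mxE => H.
  rewrite -[leLHS]real_normK ?num_real// ler_pXn2r ?nnegrE ?normr_ge0//; exact: ltW.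
rewrite -(@ltr_pXn2r _ 2) ?nnegrE ?enorm_ge0 ?(ltW r0)// enorm_sqr.
have : dotv (z - x) (z - x) <= n%:R * e ^+ 2.
  rewrite -[X in X%:R](card_ord n) mulr_natl -sumr_const ler_sum// => i _.
  by rewrite -expr2 zx.
move=> /le_lt_trans; apply.
rewrite rE exprMn ltr_pM2r ?exprn_gt0// -natrX ltr_nat.
by rewrite expnS expn1 leq_pmulr.
Qed.

(** Local form of lower semicontinuity relative to [S]. *)
Definition lsc_within n (S : set 'cV[R]_n) (f : 'cV[R]_n -> R) : Prop :=
  forall p, S p -> forall e, 0 < e -> nbhs p (fun z => S z -> f p - e < f z).

Lemma lsc_onE n (S : set 'cV[R]_n) f : lsc_on S f -> lsc_within S f.
Proof.
move=> lf p Sp e e0.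
have [|V pV fV] := lf p (f p - e); first by rewrite lte_fin ltrBlDr ltrDl.
move: pV; rewrite -[nbhs _]/(nbhs_subspace (A:=S) p) -nbhs_subspace_in// => pV.
have {}pV : nbhs p (fun z => S z -> V z) := pV.
apply: filterS pV => z Vz Sz; rewrite -lte_fin; exact: (fV z (Vz Sz)).
Qed.

Lemma lsc_within_sub n (S K : set 'cV[R]_n) f : K `<=` S ->
  lsc_within S f -> lsc_within K f.
Proof.
move=> KS lf p Kp e e0; apply: filterS (lf p (KS _ Kp) e e0) => z H Kz.
exact/H/KS.
Qed.

Lemma lsc_withinD n (S : set 'cV[R]_n) f g :
  lsc_within S f -> lsc_within S g -> lsc_within S (fun z => f z + g z).
Proof.
move=> lf lg p Sp e e0; have e2 : 0 < e / 2 by rewrite divr_gt0.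
apply: filterS2 (lf p Sp _ e2) (lg p Sp _ e2) => z Hf Hg Sz.
have := Hf Sz; have := Hg Sz; lra.
Qed.

Lemma lsc_within_sum n (S : set 'cV[R]_n) (I : finType) (f : I -> 'cV[R]_n -> R) :
  (forall i, lsc_within S (f i)) -> lsc_within S (fun z => \sum_i f i z).
Proof.
move=> lf; suff H s : lsc_within S (fun z => \sum_(i <- s) f i z) by exact: H.
elim: s => [|i s IH] p Sp e e0.
  by apply: filterE => z _; rewrite !big_nil gtrBl.
apply: filterS (lsc_withinD (lf i) IH Sp e0) => z H Sz.
by rewrite !big_cons; exact: H.
Qed.

Lemma differentiable_lsc_within n (S : set 'cV[R]_n) f :
  differentiable_on S f -> lsc_within S f.
Proof.
move=> df p Sp e e0; have [g gp] := df p Sp.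
have K0 : 0 < enorm g + 1 by rewrite ltr_wpDl// enorm_ge0.
have r0 : 0 < e / (enorm g + 1) by rewrite divr_gt0.
have gp1 : nbhs p (fun z => S z -> `|f z - f p - dotv g (z - p)| <= 1 * enorm (z - p)).
  exact: gp.
apply: filterS2 gp1 (enorm_ball_nbhs p r0) => z H zr Sz.
have := H Sz; rewrite ler_norml mul1r => /andP[{}H _].
move: zr => /=; rewrite ltr_pdivlMr// => zr.
have := dotv_ge_normM g (z - p); lra.
Qed.

(** Weierstrass: a lower semicontinuous function that is bounded below attains
    its minimum on a nonempty compact set. *)
Lemma lsc_exists_argmin n (K : set 'cV[R]_n) f B :
  compact K -> K !=set0 -> lsc_within K f -> (forall x, K x -> B <= f x) ->
  exists p, is_argmin K f p.
Proof.
move=> cK [x0 Kx0] lf fB.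
pose m := inf [set f x | x in K].
have hi : has_inf [set f x | x in K].
  split; first by exists (f x0), x0.
  by exists B => _ [x Kx <-]; exact: fB.
have mf x : K x -> m <= f x by move=> Kx; apply: ge_inf; [case: hi|exists x].
have ex k : exists x, K x /\ f x < m + k.+1%:R^-1.
  have [] := @inf_adherent _ _ (k.+1%:R^-1 : R) _ hi; first by rewrite invr_gt0 ltr0Sn.
  by move=> _ [x Kx <-] H; exists x.
have [u uP] := choice ex.
have FK : (u @ \oo) K by exists 0%N => // k _; case: (uP k).
have [p [Kp clp]] := cK (u @ \oo) _ FK.
exists p; split=> // w Kw; apply: le_trans (mf w Kw); rewrite leNgt; apply/negP => mp.
pose e := (f p - m) / 2.
have e0 : 0 < e by rewrite divr_gt0// subr_gt0.
pose V := [set z | K z /\ f z < m + e].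
have FV : (u @ \oo) V.
  exists (Num.truncn e^-1) => // k /= kt; split; first by case: (uP k).
  case: (uP k) => _ /lt_le_trans; apply; rewrite lerD2l.
  rewrite invf_ple ?posrE ?ltr0Sn// (le_trans (ltW (truncnS_gt _)))//.
  by rewrite ler_nat.
have [z [[Kz zm]]] := clp _ _ FV (lf p Kp e e0).
move=> /(_ Kz); rewrite /e in zm *; lra.
Qed.

End Attainment.

(** * Block vectors *)

Section Blocks.
Variables (R : realType) (N : nat) (d : 'I_N -> nat).
Local Notation xvec := 'cV[R]_(\sum_i d i)%N.
Implicit Types (u v : xvec) (i : 'I_N).

Lemma dotv_blk u v : dotv u v = \sum_i dotv (submxcol u i) (submxcol v i).
Proof.
rewrite dotv_mx -{1}(submxcolK u) -{1}(submxcolK v) tr_mxcol mul_mxrow_mxcol.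
by rewrite summxE; apply: eq_bigr => i _; rewrite dotv_mx.
Qed.

Lemma enorm_sqr_blk u : enorm u ^+ 2 = \sum_i enorm (submxcol u i) ^+ 2.
Proof. by rewrite enorm_sqr dotv_blk; apply: eq_bigr => i _; rewrite enorm_sqr. Qed.

Lemma enorm_blk u i : enorm (submxcol u i) <= enorm u.
Proof.
rewrite -(@ler_pXn2r _ 2) ?nnegrE ?enorm_ge0// (enorm_sqr_blk u) (bigD1 i)//=.
by rewrite lerDl sumr_ge0// => j _; rewrite sqr_ge0.
Qed.

Lemma mulmx_blk m (M : 'M[R]_(m, \sum_i d i)) u :
  M *m u = \sum_i submxrow M i *m submxcol u i.
Proof. by rewrite -{1}(submxcolK u) -{1}(submxrowK M) mul_mxrow_mxcol. Qed.

Lemma wnorm2_blk (H : forall i, 'M[R]_(d i)) u :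
  wnorm2 (\mxdiag_i H i) u = \sum_i wnorm2 (H i) (submxcol u i).
Proof.
rewrite /wnorm2 -{2}(submxcolK u) mul_mxdiag_mxcol dotv_blk.
by apply: eq_bigr => i _; rewrite mxcolK.
Qed.

Lemma submxcolZ c u i : submxcol (c *: u) i = c *: submxcol u i.
Proof. by apply/matrixP => k l; rewrite !mxE. Qed.

Lemma nbhs_blk (p : xvec) i (U : set 'cV[R]_(d i)) : nbhs (submxcol p i) U ->
  nbhs p [set z : xvec | U (submxcol z i)].
Proof.
move=> /nbhs_enorm[r r0 rU]; apply: filterS (enorm_ball_nbhs p r0) => z /= zr.
by apply: rU; rewrite -submxcolB; exact: le_lt_trans (enorm_blk _ _) zr.
Qed.

Lemma compact_blk (S : forall i, set 'cV[R]_(d i)) : (forall i, compact (S i)) ->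
  compact [set x : xvec | forall i, S i (submxcol x i)].
Proof.
move=> cS.
have := tychonoff cS; set K := (X in compact X) => cK.
rewrite (_ : [set x : xvec | _] = [set (\mxcol_i f i : xvec) | f in K]); last first.
  apply/seteqP; split => [x Sx|_ [f Kf <-] i]; last by rewrite mxcolK; exact: Kf.
  by exists (fun i => submxcol x i); rewrite ?submxcolK.
apply: continuous_compact cK; apply: continuous_subspaceT => f U /nbhs_enorm[r r0 rU].
have [e e0 rE] : exists2 e : R, 0 < e & r = N.+1%:R * e.
  by exists (r / N.+1%:R); rewrite ?divr_gt0 ?ltr0Sn// mulrC divfK// pnatr_eq0.
have Hi i : nbhs f (fun g => enorm (g i - f i) < e).
  exact: (@proj_continuous _ (fun i => 'cV[R]_(d i)) i f _ (enorm_ball_nbhs _ e0)).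
have H : nbhs f (fun g => forall i, enorm (g i - f i) < e).
  exact: filter_forall Hi.
apply: filterS H => g gf; apply: rU.
rewrite -(@ltr_pXn2r _ 2) ?nnegrE ?enorm_ge0 ?(ltW r0)// enorm_sqr_blk.
apply: (@le_lt_trans _ _ (N%:R * e ^+ 2)).
  rewrite -[X in X%:R](card_ord N) mulr_natl -sumr_const ler_sum// => i _.
  by rewrite submxcolB !mxcolK ler_pXn2r ?nnegrE ?enorm_ge0 ?(ltW e0) ?ltW.
rewrite rE exprMn ltr_pM2r ?exprn_gt0// -natrX ltr_nat.
by rewrite expnS expn1 leq_pmulr.
Qed.

End Blocks.

(** * The Gauss-Seidel coupling *)

Section CrossTerm.
Variable R : realType.

(** Exact bookkeeping for the Gauss-Seidel coupling, for sequences indexed by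
    [nat]; index 0 is the block without strong convexity, and its [p] drops
    out. *)
Lemma gauss_seidel_identity n (p q : nat -> 'cV[R]_n) m :
  let Q k := \sum_(0 <= i < k) (q i.+1 - p i.+1) in
  \sum_(0 <= j < m) dotv (q j.+1 - p j.+1) (\sum_(0 <= i < j.+1) q i)
    - dotv (Q m) (\sum_(0 <= i < m.+1) q i) + enorm (Q m) ^+ 2 / 2 =
  \sum_(0 <= j < m) ((enorm (p j.+1) ^+ 2 - enorm (q j.+1) ^+ 2) / 2
                     - dotv (p j.+1) (Q j)).
Proof.
move=> Q; elim: m => [|m IH].
  by rewrite /Q !(@big_geq _ _ _ 0 0)// dotv0l enorm0 expr0n/= mul0r subr0 addr0.
have QS : Q m.+1 = Q m + (q m.+1 - p m.+1) by rewrite /Q big_nat_recr.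
rewrite big_nat_recr//= [in RHS]big_nat_recr//= -IH QS.
rewrite (big_nat_recr m.+1)//=; set P := \sum_(0 <= i < m.+1) q i.
rewrite !enorm_sqr !dotvE (dotvC (q m.+1) (Q m)) (dotvC (p m.+1) (Q m)).
by rewrite (dotvC (q m.+1) (p m.+1)); field.
Qed.


Lemma sum_pairs (f g : nat -> R) m : (forall i, 0 <= f i) -> (forall i, 0 <= g i) ->
  \sum_(0 <= j < m.+1) \sum_(0 <= i < j) (f j + g i)
    <= m%:R * \sum_(0 <= j < m.+1) (f j + g j).
Proof.
move=> f0 g0; elim: m => [|m IH].
  by rewrite !big_nat1 big_geq// mul0r.
rewrite big_nat_recr//= (le_trans (lerD IH (lexx _)))//.
rewrite [X in _ + X <= _]big_split/= sumr_const_nat subn0 -mulr_natl.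
rewrite [in leRHS]big_nat_recr//=; set A := \sum_(0 <= i < m.+1) (f i + g i).
have : \sum_(0 <= i < m.+1) g i <= A by apply: ler_sum => i _; rewrite lerDr.
have := g0 m.+1; rewrite -(natr1 m).
have : 0 <= m%:R :> R by [].
nra.
Qed.

(** With [p] and [q] the images of the errors of the old and the new iterate,
    the Gauss-Seidel coupling minus half the squared residual telescopes up to
    terms that the strong convexity of blocks 1, 2, ... absorbs. *)
Lemma gauss_seidel_coupling n N (p q : 'I_N -> 'cV[R]_n) : (2 <= N)%N ->
  \sum_(i < N) \sum_(j < N | (i < j)%N) dotv (q j - p j) (q i)
    - enorm (\sum_i q i) ^+ 2 / 2 <=
  \sum_(j < N | (0 < j)%N)
    ((enorm (p j) ^+ 2 - enorm (q j) ^+ 2) / 2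
     + (N%:R - 2) * (3 / 2 * enorm (p j) ^+ 2 + 1 / 2 * enorm (q j) ^+ 2)).
Proof.
case: N p q => [//|[//|m]] p q _.
pose p' k := p (inord k); pose q' k := q (inord k).
have toN (F : 'I_m.+2 -> R) : \sum_(j < m.+2 | (0 < j)%N) F j =
    \sum_(0 <= j < m.+1) F (inord j.+1).
  rewrite big_mkcond big_ord_recl/= add0r big_mkord; apply: eq_bigr => i _.
  by congr F; apply: val_inj; rewrite /= inordK// ltnS.
have qE : \sum_i q i = \sum_(0 <= i < m.+2) q' i.
  by rewrite big_mkord; apply: eq_bigr => i _; rewrite /q' inord_val.
rewrite toN -/p' -/q' (exchange_big_dep xpredT)//=.
under [X in X - _ <= _]eq_bigr => j _.
  rewrite -dotv_sumr.
  over.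
have -> : \sum_(j < m.+2) dotv (q j - p j) (\sum_(i < m.+2 | (i < j)%N) q i) =
  \sum_(0 <= j < m.+1) dotv (q' j.+1 - p' j.+1) (\sum_(0 <= i < j.+1) q' i).
  rewrite big_ord_recl big1 ?dotv0r ?add0r// big_mkord; apply: eq_bigr => j _.
  have -> : lift ord0 j = inord j.+1 by apply: val_inj; rewrite /= inordK// ltnS.
  have jm : (j.+1 < m.+2)%N := ltn_ord j.
  congr dotv; rewrite big_mkord (inordK jm) (big_ord_widen m.+2 q' (ltnW jm)).
  by apply: eq_bigr => i _; rewrite /q' inord_val.
have := gauss_seidel_identity p' q' m.+1.
set Q := fun k => \sum_(0 <= i < k) _; move=> /= I.
have := dotv_le_sqr (Q m.+1) (\sum_(0 <= i < m.+2) q' i) => cs.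
rewrite qE.
set T := \sum_(0 <= j < m.+1) dotv _ _ in I *.
apply: (@le_trans _ _ (\sum_(0 <= j < m.+1)
  ((enorm (p' j.+1) ^+ 2 - enorm (q' j.+1) ^+ 2) / 2 - dotv (p' j.+1) (Q j)))).
  by rewrite -I; lra.
rewrite sumrB big_split/= lerD2l -mulr_sumr -sumrN.
have -> : m.+2%:R - 2 = m%:R :> R by rewrite -addn2 natrD addrK.
apply: (@le_trans _ _ (\sum_(0 <= j < m.+1) \sum_(0 <= i < j)
  (enorm (p' j.+1) ^+ 2 + (enorm (p' i.+1) ^+ 2 + enorm (q' i.+1) ^+ 2) / 2))).
  apply: ler_sum => j _; rewrite -dotvNr /Q -sumrN !big_mkord dotv_sumr.
  apply: ler_sum => i _; rewrite opprB dotvDr dotvNr.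
  have := dotv_le_sqr (p' j.+1) (p' i.+1).
  have := dotv_le_sqr (p' j.+1) (- q' i.+1); rewrite dotvNr enormN; lra.
apply: le_trans (sum_pairs (f := fun j => enorm (p' j.+1) ^+ 2)
  (g := fun i => (enorm (p' i.+1) ^+ 2 + enorm (q' i.+1) ^+ 2) / 2) _ _ _) _.
- by move=> i; rewrite sqr_ge0.
- by move=> i; rewrite divr_ge0// addr_ge0// sqr_ge0.
rewrite ler_wpM2l ?ler0n// ler_sum// => i _; rewrite -/p' -/q'.
rewrite -[p _]/(p' _) -[q _]/(q' _); lra.
Qed.

End CrossTerm.

(** * Structure of the problem *)

Lemma convex_onI (R : realType) n (S : set 'cV[R]_n) f :
  (forall x y t, S x -> S y -> 0 <= t <= 1 ->
     f (t *: x + (1 - t) *: y) <= t * f x + (1 - t) * f y) -> convex_on S f.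
Proof.
move=> H t x y /set_mem Sx /set_mem Sy.
by apply: H => //; apply/andP; split; [exact: ge0|exact: le1].
Qed.

Lemma is_grad_onN (R : realType) n (S : set 'cV[R]_n) f x g :
  is_grad_on S f x g -> is_grad_on S (fun z => - f z) x (- g).
Proof.
move=> H e e0.
have He : nbhs x (fun z => S z -> `|f z - f x - dotv g (z - x)| <= e * enorm (z - x)).
  exact: H.
apply: filterS He => z Hz Sz.
have -> : - f z - - f x - dotv (- g) (z - x) = - (f z - f x - dotv g (z - x)).
  by rewrite dotvNl; ring.
by rewrite normrN; exact: Hz.
Qed.

(** Young's inequality for a Lipschitz modulus [L] that may be negative: in that
    case both distances vanish. *)
Lemma lipschitz_young (R : realType) (L s c : R) : 0 <= s -> 0 <= c ->
  0 <= L * s -> 0 <= L * c -> L * s * c <= L / 2 * s ^+ 2 + L / 2 * c ^+ 2.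
Proof.
move=> s0 c0 Ls Lc; have [L0|L0] := lerP 0 L.
  have := mulr_ge0 L0 (sqr_ge0 (s - c)); lra.
have z0 r : 0 <= r -> 0 <= L * r -> r = 0.
  by move=> r0 Lr; apply/le_anti; rewrite r0 andbT -(nmulr_rge0 _ L0).
by rewrite (z0 s)// (z0 c)// mulr0 expr0n/= !mulr0 addr0.
Qed.

Section Step.
Variables (R : realType) (P : problem R).
Local Notation N := (nblk P).
Local Notation X := (@Xprod R P).
Local Notation Y := (@Yset R P).
Local Notation A := (@Amat R P).
Local Notation a := (@avec R P).
Local Notation xvec := 'cV[R]_(\sum_i @xdim R P i)%N.
Local Notation yvec := 'cV[R]_(ydim P).
Local Notation lvec := 'cV[R]_(nrow P).

Section Structure.
Hypothesis std : standing_assumptions P.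

Lemma convex_Xset i : @convex_set R 'cV[R]_(xdim i) (@Xset R P i).
Proof. by case: std => /(_ i)[]. Qed.

Lemma convex_Yset : @convex_set R yvec Y.
Proof. by case: std => _ []. Qed.

Lemma convex_Xprod : @convex_set R xvec X.
Proof.
move=> x y t /set_mem Xx /set_mem Xy; apply: mem_set => i.
rewrite /blk submxcolD !submxcolZ.
by apply: set_mem; apply: convex_Xset; apply: mem_set; [exact: Xx|exact: Xy].
Qed.

Lemma compact_Xprod : compact X.
Proof. by apply: compact_blk => i; case: std => /(_ i)[]. Qed.

Lemma compact_feasible : compact (@feasible R P).
Proof.
rewrite (_ : @feasible R P = X `&` [set x | A *m x = a]); last by apply/seteqP; split.
apply: compact_closedI; first exact: compact_Xprod.
move=> p clp; apply/eqP; rewrite -subr_eq0; apply/eqP/enorm_eq0/le_anti.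
rewrite enorm_ge0 andbT.
have [K K0 AK] := mulmx_enorm_bound A.
rewrite -oppr_ge0; apply: (@ge0_of_harmonic _ _ K) => m.
have h0 : 0 < m.+1%:R^-1 :> R by rewrite invr_gt0 ltr0Sn.
have [z [Az /= zp]] := clp _ (enorm_ball_nbhs p h0).
have -> : A *m p - a = - (A *m (z - p)) by rewrite mulmxBr Az opprB.
rewrite enormN addrC subr_ge0 mulrC.
exact: le_trans (AK (z - p)) (ler_wpM2l K0 (ltW zp)).
Qed.

End Structure.

Lemma gradx_PsiP Lx x y : convexity_assumption P Lx -> X x -> Y y ->
  is_grad_on X (fun x' => Psi x' y) x (gradx_Psi x y).
Proof.
move=> [_ _ _ /(_ y) dPsi _] Xx Yy; have [g gP] := (dPsi Yy).1 x Xx.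
by rewrite /gradx_Psi /grad_on; case: xgetP => [_ -> //|/(_ g)].
Qed.

Lemma grady_PhiP Ly x y : lipschitz_assumption P Ly -> X x -> Y y ->
  is_grad_on Y (Phi x) y (grady_Phi x y).
Proof.
move=> [dPhi _] Xx Yy; have [g gP] := dPhi x Xx y Yy.
by rewrite /grady_Phi /grad_on; case: xgetP => [_ -> //|/(_ g)].
Qed.

Lemma convex_Phi Lx y : convexity_assumption P Lx -> Y y ->
  convex_on X (fun x => Phi x y).
Proof.
move=> [_ ch _ cPsi _] Yy; apply: convex_onI => u v t Xu Xv t01.
have := convex_on_comb (cPsi y Yy).2 Xu Xv t01.
have : \sum_i hfun (blk (t *: u + (1 - t) *: v) i) y <=
  \sum_i (t * hfun (blk u i) y + (1 - t) * hfun (blk v i) y).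
  apply: ler_sum => i _; rewrite /blk submxcolD !submxcolZ.
  exact: (convex_on_comb (ch y Yy i).1 (Xu i) (Xv i) t01).
rewrite big_split/= -!mulr_sumr /Phi; lra.
Qed.

(** * The extragradient step in y *)

Lemma ystep_variational G y g yp v : standing_assumptions P -> posdef G ->
  ystep G y g yp -> Y v -> dotv g (v - yp) <= dotv (G *m (yp - y)) (v - yp).
Proof.
move=> std Gpos [Yyp minyp] Yv; have [Gsym _] := Gpos.
pose c := y + invmx G *m g.
pose q z := 1 / 2 * wnorm2 G (z - c).
have st0 : strongly_convex_on Y (fun=> 0 : R) 0.
  by move=> *; rewrite !mulr0 !mul0r addr0 subr0.
have am : is_argmin Y (fun z => 0 + q z) yp.
  by split=> // w Yw; rewrite !add0r; exact: minyp.
have := argmin_variational (convex_Yset std) (l := dotv (G *m (yp - c)) (v - yp))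
  (k := 1 / 2 * wnorm2 G (v - yp)) st0 am Yv.
rewrite mul0r mul0r subrr add0r => H.
suff /H : forall t, q (yp + t *: (v - yp)) = q yp
     + t * dotv (G *m (yp - c)) (v - yp) + t ^+ 2 * (1 / 2 * wnorm2 G (v - yp)).
  have -> : yp - c = (yp - y) - invmx G *m g by rewrite /c opprD addrA.
  rewrite mulmxBr mulmxA (mulmxV (posdef_unitmx Gpos)) mul1mx [dotv (_ - _) _]dotvDl.
  by rewrite dotvNl subr_ge0.
move=> t.
have -> : q (yp + t *: (v - yp)) = 1 / 2 * wnorm2 G ((yp - c) + t *: (v - yp)).
  by rewrite /q addrAC.
by rewrite wnorm2D// wnorm2Z dotvZr /q; field.
Qed.

Lemma extragradient_step Ly Lx G x x' y yh yp v : standing_assumptions P ->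
  convexity_assumption P Lx -> lipschitz_assumption P Ly ->
  posdef G -> loewner_ge G Ly%:M -> X x -> X x' -> Y y ->
  ystep G y (grady_Phi x y) yh -> ystep G y (grady_Phi x' yh) yp -> Y v ->
  Phi x' v - Phi x' yh <=
    1 / 2 * (wnorm2 G (v - y) - wnorm2 G (v - yp)) + Ly / 2 * enorm (x' - x) ^+ 2.
Proof.
move=> std cvx lip Gpos GL Xx Xx' Yy sh sp Yv; have [Gsym _] := Gpos.
have [Yyh _] := sh; have [Yyp _] := sp.
have V1 := ystep_variational std Gpos sp Yv.
have V2 := ystep_variational std Gpos sh Yyp.
rewrite (wnorm2_three_point _ _ _ Gsym) in V1.
rewrite (wnorm2_three_point _ _ _ Gsym) in V2.
have [concPhi _ _ _ _] := cvx.
have := grad_on_convex (convex_Yset std) (concPhi x' Xx').1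
  (is_grad_onN (grady_PhiP lip Xx' Yyh)) Yyh Yv.
rewrite dotvNl => C1.
set g' := grady_Phi x' yh in V1 C1 *; set g := grady_Phi x y in V2 *.
have E : dotv g' (v - yh) =
    dotv g' (v - yp) + dotv g (yp - yh) + dotv (g' - g) (yp - yh).
  by rewrite !dotvE; ring.
have CS := dotv_le_normM (g' - g) (yp - yh).
have L1 := lip.2 x' x yh y Xx' Xx Yyh Yy; rewrite -/g -/g' in L1.
have L2 := lip.2 x x yp yh Xx Xx Yyp Yyh.
rewrite subrr enorm0 expr0n/= add0r sqrtr_sqr (ger0_norm (enorm_ge0 _)) in L2.
set s := Num.sqrt _ in L1.
have s0 : 0 <= s := sqrtr_ge0 _.
have c0 := enorm_ge0 (yp - yh); set c := enorm (yp - yh) in CS c0 L2.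
have Ls : 0 <= Ly * s := le_trans (enorm_ge0 _) L1.
have Lc : 0 <= Ly * c := le_trans (enorm_ge0 _) L2.
have CS2 : dotv (g' - g) (yp - yh) <= Ly * s * c.
  exact: le_trans CS (ler_wpM2r c0 L1).
have s2 : s ^+ 2 = enorm (x' - x) ^+ 2 + enorm (yh - y) ^+ 2.
  by rewrite sqr_sqrtr// addr_ge0// sqr_ge0.
have AG := lipschitz_young s0 c0 Ls Lc.
have G1 := loewner_ge_scalar (yp - yh) GL; rewrite -/c in G1.
have G2 := loewner_ge_scalar (yh - y) GL.
have L2s : Ly * s ^+ 2 = Ly * enorm (x' - x) ^+ 2 + Ly * enorm (yh - y) ^+ 2.
  by rewrite s2 mulrDr.
move: V1 V2 C1 E AG CS2 G1 G2 L2s => /=.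
move: (Phi x' v) (Phi x' yh) (wnorm2 G (v - y)) (wnorm2 G (v - yp)).
move: (wnorm2 G (yp - y)) (wnorm2 G (yp - yh)) (wnorm2 G (yh - y)).
move: (dotv g' (v - yh)) (dotv g' (v - yp)) (dotv g (yp - yh)).
move: (dotv (g' - g) (yp - yh)) (enorm (yh - y)) (enorm (x' - x)).
move: s c {s0 c0 Ls Lc s2 L1 L2 CS}.
move: Ly {lip GL}; clear; move=> *; lra.
Qed.

(** * The proximal ADMM step in x *)

Lemma gauss_seidel_segment (xp x : xvec) (i : 'I_N) (w z : 'cV[R]_(xdim i)) t :
  gauss_seidel_point xp x (w + t *: z) =
  gauss_seidel_point xp x w
    + t *: \mxcol_j eqtype.dfwith (fun k : 'I_N => 0 : 'cV[R]_(xdim k)) z j.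
Proof.
apply/mxcolP => j; rewrite submxcolD submxcolZ !mxcolK.
case: (eqVneq i j) => [<-|ij]; first by rewrite !dfwith_in.
by rewrite !dfwith_out// scaler0 addr0.
Qed.

Lemma mulmx_dfwith (i : 'I_N) m (M : 'M[R]_(m, \sum_i @xdim R P i))
    (z : 'cV[R]_(xdim i)) :
  M *m (\mxcol_j eqtype.dfwith (fun k : 'I_N => 0 : 'cV[R]_(xdim k)) z j) =
  submxrow M i *m z.
Proof.
rewrite mulmx_blk (bigD1 i)//= mxcolK dfwith_in big1 ?addr0// => j ji.
by rewrite mxcolK dfwith_out ?mulmx0// eq_sym.
Qed.

Lemma dotv_dfwith (i : 'I_N) (g : xvec) (z : 'cV[R]_(xdim i)) :
  dotv g (\mxcol_j eqtype.dfwith (fun k : 'I_N => 0 : 'cV[R]_(xdim k)) z j) =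
  dotv (blk g i) z.
Proof.
rewrite dotv_blk (bigD1 i)//= mxcolK dfwith_in big1 ?addr0// => j ji.
by rewrite mxcolK dfwith_out ?dotv0r// eq_sym.
Qed.

Lemma blk_gauss_seidel (xp x : xvec) (i k : 'I_N) (w : 'cV[R]_(xdim i)) : k != i ->
  blk (gauss_seidel_point xp x w) k = if (k < i)%N then blk xp k else blk x k.
Proof. by move=> ki; rewrite /blk mxcolK dfwith_out// eq_sym. Qed.

(** The residual seen by block [i] during the sweep. *)
Lemma gauss_seidel_residual (xp x : xvec) (i : 'I_N) :
  A *m gauss_seidel_point xp x (blk xp i) - a =
  A *m xp - a - \sum_(j < N | (i < j)%N) Ablk j *m (blk xp j - blk x j).
Proof.
rewrite addrAC; congr (_ - a); rewrite !mulmx_blk [X in _ - X]big_mkcond/= -sumrB.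
apply: eq_bigr => j _; rewrite -/(Ablk j) -!/(blk _ _).
case: (ltngtP i j) => [ij|ij|/ord_inj <-].
- by rewrite blk_gauss_seidel ?ltnNge ?(ltnW ij)//= ?mulmxBr ?subKr// neq_ltn ij orbT.
- by rewrite blk_gauss_seidel ?ij ?subr0// neq_ltn ij.
- by rewrite subr0 /blk mxcolK dfwith_in.
Qed.

Lemma prox_block_variational (x xp : xvec) lam y gamma H mu (i : 'I_N) w :
  standing_assumptions P -> (H i)^T = H i ->
  is_argmin (@Xset R P i)
     (fun w => lin_aug_lagrangian gamma (gauss_seidel_point xp x w) lam x y
               + 1 / 2 * wnorm2 (H i) (w - blk x i))
     (blk xp i) ->
  strongly_convex_on (@Xset R P i) (fun w => hfun w y) mu ->
  Xset w ->
  mu / 2 * enorm (w - blk xp i) ^+ 2 <=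
    hfun w y - hfun (blk xp i) y +
    (dotv (blk (gradx_Psi x y) i) (w - blk xp i)
     - dotv lam (Ablk i *m (w - blk xp i))
     + gamma * dotv (A *m gauss_seidel_point xp x (blk xp i) - a)
                    (Ablk i *m (w - blk xp i))
     + dotv (H i *m (blk xp i - blk x i)) (w - blk xp i)).
Proof.
move=> std Hsym am sc Xw.
set obj := (fun w => _) in am.
pose f (w : 'cV[R]_(xdim i)) := hfun w y.
have am' : is_argmin (@Xset R P i) (fun z => f z + (obj z - f z)) (blk xp i).
  by case: am => ? am; split=> // z Xz; rewrite ![_ + (_ - _)]addrC !subrK; exact: am.
set d := w - blk xp i; set r := A *m _ - a.
apply: (argmin_variational (@convex_Xset std i) (f := f) (q := fun z => obj z - f z)
  (k := gamma / 2 * enorm (Ablk i *m d) ^+ 2 + 1 / 2 * wnorm2 (H i) d) sc am' Xw) => t.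
rewrite -/d /obj /f gauss_seidel_segment /lin_aug_lagrangian.
set Z := gauss_seidel_point xp x (blk xp i) in r *.
set E := \mxcol_j _.
have hs : \sum_k hfun (blk (Z + t *: E) k) y - hfun (blk xp i + t *: d) y =
          \sum_k hfun (blk Z k) y - hfun (blk xp i) y.
  have Zi s : blk (Z + s *: E) i = blk xp i + s *: d.
    by rewrite /blk submxcolD submxcolZ !mxcolK !dfwith_in.
  rewrite (bigD1 i)//= [in RHS](bigD1 i)//= Zi.
  have -> : blk Z i = blk xp i by rewrite /blk mxcolK dfwith_in.
  rewrite addrAC subrr add0r addrAC subrr add0r; apply: eq_bigr => k ki.
  rewrite /blk submxcolD submxcolZ !mxcolK.
  by rewrite [X in _ + t *: X]dfwith_out 1?eq_sym// scaler0 addr0.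
have AE : A *m (Z + t *: E) - a = r + t *: (Ablk i *m d).
  by rewrite mulmxDr -scalemxAr mulmx_dfwith addrAC.
rewrite AE -/r.
have -> : Z + t *: E - x = (Z - x) + t *: E by rewrite addrAC.
have -> : blk xp i + t *: d - blk x i = (blk xp i - blk x i) + t *: d by rewrite addrAC.
rewrite wnorm2D// wnorm2Z dotvZr.
rewrite [dotv _ (Z - x + _)]dotvDr dotvZr dotv_dfwith.
clearbody r.
rewrite !enorm_sqr !(dotvDl, dotvDr, dotvZl, dotvZr) (dotvC (Ablk i *m d) r).
by move/eqP: hs; rewrite subr_eq => /eqP ->; field.
Qed.

Lemma prox_admm_in (x xp : xvec) lam lamp y gamma H :
  prox_admm x lam y gamma H xp lamp -> X xp.
Proof. by move=> [am _] i; case: (am i). Qed.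

Lemma blkB (u v : xvec) i : blk (u - v) i = blk u i - blk v i.
Proof. exact: submxcolB. Qed.

(** Moving a multiplier [lam] along the residual, measured against a test
    multiplier. *)
Lemma multiplier_step (gamma : R) (lam lt r : lvec) : 0 < gamma ->
  (enorm (lam - lt) ^+ 2 - enorm (lam - gamma *: r - lt) ^+ 2) / (2 * gamma) =
  dotv (lam - lt) r - gamma / 2 * enorm r ^+ 2.
Proof.
move=> g0; rewrite addrAC; set l := lam - lt; clearbody l.
rewrite !enorm_sqr !dotvE (dotvC r l).
by field; rewrite gt_eqF.
Qed.

(** One proximal ADMM sweep, tested against a feasible point [u] and a multiplier
    [lt].  The last sum is the coupling of the sweep, still to be paid for by the
    strong convexity of the blocks other than the first. *)
Lemma prox_admm_step Lx mu gamma H (x xp : xvec) lam lamp y u lt :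
  standing_assumptions P -> convexity_assumption P Lx ->
  partial_strong_convexity_assumption mu ->
  (forall i, (H i)^T = H i) -> 0 < gamma -> (2 <= N)%N ->
  X x -> Y y -> prox_admm x lam y gamma H xp lamp -> feasible u ->
  Phi xp y - Phi u y - dotv lt (A *m xp - a) <=
    (enorm (lam - lt) ^+ 2 - enorm (lamp - lt) ^+ 2) / (2 * gamma)
    + 1 / 2 * (wnorm2 (\mxdiag_i H i) (u - x) - wnorm2 (\mxdiag_i H i) (u - xp)
               - wnorm2 (\mxdiag_i H i) (xp - x))
    + Lx / 2 * enorm (xp - x) ^+ 2
    + \sum_(j < N | (0 < j)%N)
       (gamma * ((enorm (Ablk j *m (blk x j - blk u j)) ^+ 2
                   - enorm (Ablk j *m (blk xp j - blk u j)) ^+ 2) / 2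
                + (N%:R - 2) * (3 / 2 * enorm (Ablk j *m (blk x j - blk u j)) ^+ 2
                       + 1 / 2 * enorm (Ablk j *m (blk xp j - blk u j)) ^+ 2))
        - mu j / 2 * enorm (blk u j - blk xp j) ^+ 2).
Proof.
move=> std cvx psc Hsym g0 N2 Xx Yy pa [Xu Au].
have Xxp := prox_admm_in pa; have [am ->] := pa.
have [_ ch _ cPsi LPsi] := cvx.
rewrite multiplier_step//.
set r := A *m xp - a; set g := gradx_Psi x y.
pose p (i : 'I_N) := Ablk i *m (blk x i - blk u i).
pose q (i : 'I_N) := Ablk i *m (blk xp i - blk u i).
pose mu0 (i : 'I_N) := if (0 < i)%N then mu i else 0.
have sc i : strongly_convex_on (@Xset R P i) (fun w => hfun w y) (mu0 i).
  rewrite /mu0; case: ifP => i0; first by have [_ /(_ y Yy)] := psc i i0.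
  exact: convex_on_strongly (ch y Yy i).1.
have qr : \sum_i q i = r.
  rewrite /r -Au -mulmxBr mulmx_blk; apply: eq_bigr => i _.
  by rewrite submxcolB.
have Aq i : Ablk i *m (blk u i - blk xp i) = - q i by rewrite -mulmxN opprB.
have block i : mu0 i / 2 * enorm (blk u i - blk xp i) ^+ 2 <=
    hfun (blk u i) y - hfun (blk xp i) y + dotv (blk g i) (blk (u - xp) i)
    + dotv lam (q i)
    + gamma * (\sum_(j < N | (i < j)%N) dotv (q j - p j) (q i) - dotv r (q i))
    + 1 / 2 * (wnorm2 (H i) (blk (u - x) i) - wnorm2 (H i) (blk (u - xp) i)
               - wnorm2 (H i) (blk (xp - x) i)).
  have := prox_block_variational std (Hsym i) (am i) (sc i) (Xu i).
  rewrite Aq gauss_seidel_residual -/r -/g.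
  rewrite (wnorm2_three_point _ _ _ (Hsym i)) -!blkB.
  rewrite [dotv (r - _) _]dotvDl dotvNl !dotvNr.
  have -> : dotv (\sum_(j < N | (i < j)%N) Ablk j *m (blk xp j - blk x j)) (q i) =
            \sum_(j < N | (i < j)%N) dotv (q j - p j) (q i).
    rewrite dotvC dotv_sumr; apply: eq_bigr => j _; rewrite dotvC; congr dotv.
    by rewrite /q /p -mulmxBr opprB addrA subrK.
  move=> H1; apply: le_trans H1 _; rewrite -subr_ge0 le_eqVlt; apply/orP; left.
  by apply/eqP; ring.
have := @ler_sum _ _ (index_enum _) xpredT _ _ (fun i _ => block i).
rewrite !big_split/= -!mulr_sumr !big_split/= !sumrN.
rewrite -!(wnorm2_blk H) -!dotv_blk -!dotv_sumr qr.
move=> {block} B0.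
have coup := gauss_seidel_coupling p q N2; rewrite qr in coup.
have desc := convex_descent (convex_Xprod std) (cPsi y Yy).2
  (G := fun z => gradx_Psi z y) (fun z Xz => gradx_PsiP cvx Xz Yy)
  (fun z Xz => LPsi z x y Xz Xx Yy) Xx Xxp.
have grad := grad_on_convex (convex_Xprod std) (cPsi y Yy).2
  (gradx_PsiP cvx Xx Yy) Xx Xu.
rewrite -/g in desc grad.
have gE : dotv g (u - xp) = dotv g (u - x) - dotv g (xp - x).
  by rewrite !dotvE; ring.
have muE : \sum_i mu0 i / 2 * enorm (blk u i - blk xp i) ^+ 2 =
   \sum_(j < N | (0 < j)%N) mu j / 2 * enorm (blk u j - blk xp j) ^+ 2.
  rewrite [RHS]big_mkcond; apply: eq_bigr => i _; rewrite /mu0; case: ifP => // _.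
  by rewrite !mul0r.
rewrite muE in B0.
rewrite -big_split/= dotvDl dotvNl /Phi.
have {}coup := ler_wpM2l (ltW g0) coup.
rewrite -[dotv r r]enorm_sqr in B0.
move: B0 coup desc grad gE; rewrite /p /q => {muE qr Aq sc mu0}.
set S1 := \sum_(_ < _ | _) mu _ / 2 * _.
set S2 := \sum_(_ < _ | _) (_ / 2 + _).
set S3 := \sum_(_ < _) \sum_(_ < _ | _) _.
set S4 := \sum_(_ < _) hfun (blk u _) y.
set S5 := \sum_(_ < _) hfun (blk xp _) y.
move: S1 S2 S3 S4 S5 (wnorm2 _ _) (wnorm2 _ (u - xp)) (wnorm2 _ (xp - x)).
move: (dotv g (u - xp)) (dotv g (u - x)) (dotv g (xp - x)) (dotv lam r) (dotv lt r).
move: (Psi u y) (Psi xp y) (Psi x y) (enorm r) (enorm (xp - x)).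
clear; move=> *; lra.
Qed.

End Step.

(** * Telescoping along a run *)

(** The strong convexity of a block pays for its coupling.  Here [n] is the number
    of blocks, [s] the norm of the constraint block, [D] the distance of the new
    iterate to the test point, and [p], [q] are the sizes of the images of the old
    and the new error.  Up to telescoping terms the coupling costs 2 (n - 2) times
    gamma [q]^2, while strong convexity yields at least n (n - 1) / 2
    times it. *)
Lemma block_absorption (R : realFieldType) (n gamma mu s D p q : R) :
  3 <= n -> 0 <= gamma -> n * (n - 1) * gamma * s ^+ 2 <= mu ->
  0 <= q -> q ^+ 2 <= s ^+ 2 * D ^+ 2 ->
  gamma * ((p ^+ 2 - q ^+ 2) / 2
      + (n - 2) * (3 / 2 * p ^+ 2 + 1 / 2 * q ^+ 2)) - mu / 2 * D ^+ 2
    <= gamma * (1 / 2 + 3 / 2 * (n - 2)) * (p ^+ 2 - q ^+ 2).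
Proof.
move=> n3 g0 gs q0 qs.
have D0 : 0 <= D ^+ 2 := sqr_ge0 D.
have H1 := ler_wpM2r D0 gs.
have nn : 0 <= n * (n - 1) * gamma by rewrite !mulr_ge0//; lra.
have H2 := ler_wpM2l nn qs.
(* n (n - 1) - 4 (n - 2) = (n - 5 / 2)^2 + 7 / 4 *)
have H3 : gamma * q ^+ 2 * (4 * (n - 2)) <= gamma * q ^+ 2 * (n * (n - 1)).
  rewrite ler_wpM2l ?mulr_ge0 ?sqr_ge0//.
  have := sqr_ge0 (n - 5 / 2); rewrite !expr2; lra.
lra.
Qed.

Lemma half_le (R : realFieldType) (z w : R) : 0 <= z -> z <= w -> 1 / 2 * z <= w.
Proof. by move=> *; lra. Qed.

Section Convergence.
Variables (R : realType) (P : problem R).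
Local Notation N := (nblk P).
Local Notation X := (@Xprod R P).
Local Notation Y := (@Yset R P).
Local Notation A := (@Amat R P).
Local Notation a := (@avec R P).
Local Notation xvec := 'cV[R]_(\sum_i @xdim R P i)%N.
Local Notation yvec := 'cV[R]_(ydim P).
Local Notation lvec := 'cV[R]_(nrow P).

Lemma seg_gammaP mu gamma : standing_assumptions P ->
  partial_strong_convexity_assumption mu -> (3 <= N)%N -> seg_gamma mu gamma ->
  0 < gamma /\ forall i : 'I_N, (0 < i)%N ->
    N%:R * (N%:R - 1) * gamma * spectral_norm (Ablk i) ^+ 2 <= mu i.
Proof.
move=> [_ _ Aneq0 _] psc N3 [m [[i /= i0 mE] minm] ->].
have s0 (j : 'I_N) : (0 < j)%N -> 0 < spectral_norm (Ablk j) ^+ 2.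
  by move=> j0; rewrite exprn_gt0// spectral_norm_gt0// Aneq0.
have n3 : 3 <= N%:R :> R by rewrite ler_nat.
have nn : 0 < N%:R * (N%:R - 1) :> R by rewrite mulr_gt0//; lra.
split.
  rewrite mul1r mulr_gt0 ?invr_gt0// -mE divr_gt0 ?s0//.
  by case: (psc i i0).
move=> j j0; rewrite mul1r mulVKf ?gt_eqF// -ler_pdivlMr ?s0//.
by apply: minm; exists j.
Qed.

(** The Lyapunov function of the method relative to the test points [u], [v] and
    the test multiplier [lt]. *)
Definition potential gamma G (H : forall i : 'I_N, 'M[R]_(xdim i))
    (u : xvec) (v : yvec) (lt : lvec) (x : xvec) (lam : lvec) (y : yvec) : R :=
  enorm (lam - lt) ^+ 2 / (2 * gamma)
  + 1 / 2 * wnorm2 G (v - y)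
  + 1 / 2 * wnorm2 (\mxdiag_i H i) (u - x)
  + gamma * (1 / 2 + 3 / 2 * (N%:R - 2)) *
      \sum_(j < N | (0 < j)%N) enorm (Ablk j *m (blk x j - blk u j)) ^+ 2.

Section Run.
Variables (Lx Ly : R) (mu : 'I_N -> R) (gamma : R)
  (G : 'M[R]_(ydim P)) (H : forall i : 'I_N, 'M[R]_(xdim i)).
Hypotheses (N3 : (3 <= N)%N) (std : standing_assumptions P)
  (cvx : convexity_assumption P Lx) (psc : partial_strong_convexity_assumption mu)
  (lip : lipschitz_assumption P Ly)
  (Hpos : forall i, posdef (H i) /\ loewner_ge (H i) (Lx + Ly)%:M)
  (Gpos : posdef G) (GL : loewner_ge G Ly%:M) (gammaE : seg_gamma mu gamma).

Let gamma_gt0 : 0 < gamma := (seg_gammaP std psc N3 gammaE).1.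
Let n3 : 3 <= N%:R :> R. Proof. by rewrite ler_nat. Qed.

Lemma potential_ge0 u v lt x lam y : 0 <= potential gamma G H u v lt x lam y.
Proof.
have H0 z : 0 <= wnorm2 (\mxdiag_i H i) z.
  by rewrite wnorm2_blk sumr_ge0// => i _; exact: posdef_ge0 (Hpos i).1.
apply: addr_ge0; first apply: addr_ge0; first apply: addr_ge0.
- by rewrite divr_ge0 ?sqr_ge0// mulr_ge0// ltW.
- by rewrite mulr_ge0 ?divr_ge0// posdef_ge0.
- by rewrite mulr_ge0// divr_ge0.
- rewrite mulr_ge0//; last by rewrite sumr_ge0// => i _; rewrite sqr_ge0.
  by rewrite mulr_ge0 ?(ltW gamma_gt0)//; move: n3; lra.
Qed.

(** Along one iteration the potential decreases by at least the gap of the new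
    iterates at the test points, the multiplier term included. *)
Lemma seg_admm_step (x xp u : xvec) (y yh yp v : yvec) lam lamp lt :
  X x -> Y y -> feasible u -> Y v ->
  ystep G y (grady_Phi x y) yh -> prox_admm x lam yh gamma H xp lamp ->
  ystep G y (grady_Phi xp yh) yp ->
  Phi xp v - Phi u yh - dotv lt (A *m xp - a) <=
  potential gamma G H u v lt x lam y - potential gamma G H u v lt xp lamp yp.
Proof.
move=> Xx Yy Fu Yv sh pa sp; have Xxp := prox_admm_in pa; have [Yyh _] := sh.
have Hsym i : (H i)^T = H i by case: (Hpos i) => -[].
have S1 := prox_admm_step lt std cvx psc Hsym gamma_gt0 (ltnW N3) Xx Yyh pa Fu.
have S2 := extragradient_step std cvx lip Gpos GL Xx Xxp Yy sh sp Yv.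
have S3 : (Lx + Ly) * enorm (xp - x) ^+ 2 <= wnorm2 (\mxdiag_i H i) (xp - x).
  rewrite wnorm2_blk enorm_sqr_blk mulr_sumr; apply: ler_sum => i _.
  exact: loewner_ge_scalar (Hpos i).2.
have S4 : \sum_(j < N | (0 < j)%N)
       (gamma * ((enorm (Ablk j *m (blk x j - blk u j)) ^+ 2
                   - enorm (Ablk j *m (blk xp j - blk u j)) ^+ 2) / 2
                + (N%:R - 2) * (3 / 2 * enorm (Ablk j *m (blk x j - blk u j)) ^+ 2
                       + 1 / 2 * enorm (Ablk j *m (blk xp j - blk u j)) ^+ 2))
        - mu j / 2 * enorm (blk u j - blk xp j) ^+ 2) <=
   gamma * (1 / 2 + 3 / 2 * (N%:R - 2)) *
     (\sum_(j < N | (0 < j)%N) enorm (Ablk j *m (blk x j - blk u j)) ^+ 2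
      - \sum_(j < N | (0 < j)%N) enorm (Ablk j *m (blk xp j - blk u j)) ^+ 2).
  rewrite -sumrB mulr_sumr; apply: ler_sum => j j0.
  apply: (@block_absorption _ _ _ _ (spectral_norm (Ablk j))) => //.
  - exact: ltW.
  - exact: (seg_gammaP std psc N3 gammaE).2.
  - exact: enorm_ge0.
  - rewrite -exprMn ler_pXn2r ?nnegrE ?mulr_ge0 ?spectral_norm_ge0 ?enorm_ge0//.
    by rewrite -(enormN (blk u j - blk xp j)) opprB spectral_normP.
rewrite /potential; move: S1 S2 S3 S4.
set S := \sum_(j < N | _) (_ - _).
set Sp := \sum_(j < N | _) enorm (Ablk j *m (blk xp j - _)) ^+ 2.
set Sx := \sum_(j < N | _) enorm (Ablk j *m (blk x j - _)) ^+ 2.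
move: S Sp Sx (gamma * _) => S Sp Sx W.
move: (wnorm2 (\mxdiag_i H i) (u - x)) (wnorm2 (\mxdiag_i H i) (u - xp)).
move: (wnorm2 (\mxdiag_i H i) (xp - x)) (wnorm2 G (v - y)) (wnorm2 G (v - yp)).
move: (dotv lt _) (enorm (xp - x)) (Phi xp v) (Phi u yh) (Phi xp yh).
rewrite mulrBl; move: (_ / (2 * gamma)) (_ / (2 * gamma)).
clear; move=> *; lra.
Qed.

Section Iterates.
Variables (x : nat -> xvec) (y yh : nat -> yvec) (lam : nat -> lvec).
Hypothesis run : seg_admm gamma G H x y yh lam.

Lemma seg_admm_X k : X (x k).
Proof.
case: run => X0 _ _ step; case: k => [//|k].
by case: (step k) => _ /prox_admm_in.
Qed.

Lemma seg_admm_Y k : Y (y k).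
Proof.
by case: run => _ Y0 _ step; case: k => [//|k]; case: (step k) => _ _ [].
Qed.

Lemma seg_admm_Yh k : Y (yh k.+1).
Proof. by case: run => _ _ _ step; case: (step k) => -[]. Qed.

Lemma ergodic_X T : (0 < T)%N -> X (ergodic x T).
Proof.
by move=> T0; apply: (ergodic_in (@convex_Xprod _ _ std)) => // k; exact: seg_admm_X.
Qed.

Lemma ergodic_Y T : (0 < T)%N -> Y (ergodic yh T).
Proof.
by move=> T0; apply: (ergodic_in (@convex_Yset _ _ std)) => // k; exact: seg_admm_Yh.
Qed.

Lemma seg_admm_sum u v lt T : feasible u -> Y v ->
  \sum_(1 <= k < T.+1) (Phi (x k) v - Phi u (yh k) - dotv lt (A *m x k - a)) <=
  potential gamma G H u v lt (x 0%N) (lam 0%N) (y 0%N).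
Proof.
move=> Fu Yv; rewrite -subr_ge0.
apply: le_trans (potential_ge0 u v lt (x T) (lam T) (y T)) _.
elim: T => [|T IH]; first by rewrite big_geq// subr0.
rewrite big_nat_recr//= opprD addrA.
case: run => _ _ _ /(_ T)[sh pa sp].
have H1 := seg_admm_step lt (seg_admm_X T) (seg_admm_Y T) Fu Yv sh pa sp.
by rewrite lerBrDr; apply: le_trans IH; rewrite -lerBrDl.
Qed.

(** The averaged estimate against arbitrary test points and multiplier. *)
Lemma seg_admm_ergodic u v lt T : (0 < T)%N -> feasible u -> Y v ->
  Phi (ergodic x T) v - Phi u (ergodic yh T) - dotv lt (A *m ergodic x T - a) <=
  T%:R^-1 * potential gamma G H u v lt (x 0%N) (lam 0%N) (y 0%N).
Proof.
move=> T0 Fu Yv; have [Xu _] := Fu.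
have t0 : T%:R != 0 :> R by rewrite pnatr_eq0 -lt0n.
have ti : 0 <= T%:R^-1 :> R by rewrite invr_ge0 ler0n.
have J1 := convex_on_ergodic (@convex_Xprod _ _ std) (convex_Phi cvx Yv) T0
  (fun k => seg_admm_X k.+1).
have [/(_ u Xu) [conc _] _ _ _ _] := cvx.
have J2 := convex_on_ergodic (@convex_Yset _ _ std) conc T0 seg_admm_Yh.
have E : dotv lt (A *m ergodic x T - a) =
    T%:R^-1 * \sum_(1 <= k < T.+1) dotv lt (A *m x k - a).
  rewrite -dotv_sumr -dotvZr sumrB sumr_const_nat subn1/= scalerBr.
  congr dotv; congr (_ - _).
    by rewrite /ergodic -scalemxAr mulmx_sumr.
  by rewrite -(scaler_nat T a) scalerA mulVf// scale1r.
have := ler_wpM2l ti (seg_admm_sum lt T Fu Yv).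
rewrite !sumrB !mulrBr -E; apply: le_trans.
rewrite lerD2r; apply: lerB => //.
by rewrite -lerN2 -mulrN -sumrN.
Qed.

Lemma potential_init u v lt rho : feasible u -> Y v -> enorm lt <= rho ->
  potential gamma G H u v lt (x 0%N) (lam 0%N) (y 0%N) <=
  rate_numerator gamma rho G H.
Proof.
move=> [Xu _] Yv ltr; case: run => X0 Y0 -> _.
have rho0 : 0 <= rho := le_trans (enorm_ge0 lt) ltr.
have [cX [cY _] _ _] := std.
rewrite /potential /rate_numerator; apply: lerD; first apply: lerD; first apply: lerD.
- rewrite sub0r enormN invfM mulrA ler_wpM2r ?invr_ge0 ?(ltW gamma_gt0)//.
  have : enorm lt ^+ 2 <= rho ^+ 2 by rewrite ler_pXn2r ?nnegrE ?enorm_ge0.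
  have n1 : 1 <= N%:R ^+ 2 :> R by rewrite exprn_ege1// (le_trans _ n3)// ler1n.
  have := ler_wpM2r (sqr_ge0 rho) n1; rewrite mul1r.
  have := sqr_ge0 rho; lra.
- apply: half_le; first exact: posdef_ge0.
  apply: le_trans (wnorm2_le _ _) _; rewrite ler_wpM2l ?spectral_norm_ge0//.
  by rewrite ler_pXn2r ?nnegrE ?enorm_ge0 ?(diam_ge0 cY Yv)// diamP.
- apply: half_le.
    by rewrite wnorm2_blk sumr_ge0// => i _; exact: posdef_ge0 (Hpos i).1.
  apply: le_trans (wnorm2_le _ _) _; rewrite ler_wpM2l ?spectral_norm_ge0//.
  have -> : DX P ^+ 2 = \sum_i diam (@Xset R P i) ^+ 2.
    by rewrite /DX sqr_sqrtr// sumr_ge0// => i _; exact: sqr_ge0.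
  rewrite enorm_sqr_blk; apply: ler_sum => i _; rewrite submxcolB.
  rewrite ler_pXn2r ?nnegrE ?enorm_ge0 ?(diam_ge0 (cX i).1 (Xu i))//.
  exact: diamP (cX i).1 (Xu i) (X0 i).
rewrite -mulrA ler_wpM2l ?(ltW gamma_gt0)// mulr_sumr; apply: ler_sum => j j0.
have s0 := spectral_norm_ge0 (Ablk j).
have d0 := diam_ge0 (cX j).1 (Xu j).
have : enorm (Ablk j *m (blk (x 0%N) j - blk u j)) ^+ 2 <=
    (spectral_norm (Ablk j) * diam (@Xset R P j)) ^+ 2.
  rewrite ler_pXn2r ?nnegrE ?mulr_ge0 ?enorm_ge0//.
  apply: le_trans (spectral_normP _ _) _; rewrite ler_wpM2l//.
  exact: diamP (cX j).1 (X0 j) (Xu j).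
rewrite exprMn => HD.
have W0 : 0 <= 1 / 2 + 3 / 2 * (N%:R - 2) :> R by move: n3; lra.
apply: le_trans (ler_wpM2l W0 HD) _.
rewrite -[leRHS]mulrA ler_wpM2r ?mulr_ge0 ?sqr_ge0//.
have j1 : 1 <= j%:R :> R by rewrite ler1n.
rewrite -(natr1 j); move: n3 j1; move: (N%:R : R) (j%:R : R) => nn jj n3' j1.
have : 0 <= (2 * nn + jj + 1) * (jj - 1) by rewrite mulr_ge0//; lra.
lra.
Qed.

End Iterates.
End Run.
End Convergence.

(** * The saddle gap and the penalty for infeasibility *)

Lemma mulmx_preimage_bound (R : realType) m n (M : 'M[R]_(m, n)) :
  exists2 K, 0 <= K & forall z : 'cV[R]_n,
    exists2 w, M *m w = M *m z & enorm w <= K * enorm (M *m z).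
Proof.
have [K K0 MK] := mulmx_enorm_bound (pinvmx M^T)^T.
exists K => // z; exists ((pinvmx M^T)^T *m (M *m z)); last exact: MK.
apply: trmx_inj; rewrite trmx_mul [((pinvmx _)^T *m _)^T]trmx_mul trmxK.
by apply: mulmxKpV; rewrite trmx_mul submxMl.
Qed.

Section Gap.
Variables (R : realType) (P : problem R).
Local Notation N := (nblk P).
Local Notation X := (@Xprod R P).
Local Notation Y := (@Yset R P).
Local Notation A := (@Amat R P).
Local Notation a := (@avec R P).
Local Notation xvec := 'cV[R]_(\sum_i @xdim R P i)%N.
Local Notation yvec := 'cV[R]_(ydim P).

Variable Lx : R.
Hypotheses (std : standing_assumptions P) (cvx : convexity_assumption P Lx).

Lemma Phi_max_attained (x : xvec) : X x ->
  exists2 v, Y v & is_max [set Phi x y' | y' in Y] (Phi x v).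
Proof.
move=> Xx; have [_ [cY _] _ [_ [yc [_ /interior_subset Yc _]]]] := std.
have [/(_ x Xx) [_ usc] _ [B PhiB] _ _] := cvx.
have Y0 : Y !=set0 by exists yc.
have [|v [Yv vmin]] := lsc_exists_argmin (B := - B) cY Y0 (lsc_onE usc).
  by move=> z Yz; rewrite lerN2 (le_trans (ler_norm _))// PhiB.
exists v => //; split; first by exists v.
by move=> _ [z Yz <-]; rewrite -lerN2 vmin.
Qed.

Lemma lsc_within_Phi y : Y y -> lsc_within X (fun x => Phi x y).
Proof.
move=> Yy; have [_ ch _ cPsi _] := cvx.
apply: lsc_withinD; last exact: differentiable_lsc_within (cPsi y Yy).1.
apply: lsc_within_sum => i p Xp e e0.
have [_ /lsc_onE /(_ _ (Xp i) e e0) /nbhs_blk H] := ch y Yy i.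
by apply: filterS H => z Hz Xz; exact: Hz.
Qed.

Lemma Phi_min_attained y : Y y ->
  exists2 u, feasible u & is_min [set Phi x' y | x' in @feasible R P] (Phi u y).
Proof.
move=> Yy; have [_ _ _ [xc [_ [/interior_subset Xc _ Axc]]]] := std.
have [_ _ [B PhiB] _ _] := cvx.
have FX : @feasible R P `<=` X by move=> ? [].
have F0 : @feasible R P !=set0 by exists xc.
have [|u [Fu umin]] := lsc_exists_argmin (B := - B) (compact_feasible std) F0
  (lsc_within_sub FX (lsc_within_Phi Yy)).
  by move=> z [Xz _]; rewrite lerNl (le_trans (ler_norm _))// normrN PhiB.
exists u => //; split; first by exists u.
by move=> _ [z Fz <-]; exact: umin.
Qed.

(** Exact penalty: uniformly in [y], the constrained minimum of [Phi] exceeds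
    [Phi x y] by at most a multiple of the residual of [x].  The point [x] is made
    feasible by moving it towards a Slater point that has been shifted, within its
    ball of freedom, so as to overcompensate the residual. *)
Lemma exact_penalty : exists2 L, 0 <= L & forall x y m, X x -> Y y ->
  is_min [set Phi x' y | x' in @feasible R P] m ->
  m <= Phi x y + L * enorm (A *m x - a).
Proof.
have [_ _ _ [xc [yc [Xi /interior_subset Yc Axc]]]] := std.
have Xc := interior_subset Xi.
have [_ _ [B PhiB] _ _] := cvx.
have B0 : 0 <= B := le_trans (normr_ge0 _) (PhiB xc yc Xc Yc).
have [r r0 rX] := nbhs_enorm Xi.
have [K K0 MK] := mulmx_preimage_bound A.
have r2 : 0 < r / 2 by rewrite divr_gt0.
have K1 : 0 < K + 1 by rewrite ltr_wpDl.
exists (2 * B * (K + 1) / (r / 2)).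
  by rewrite divr_ge0 ?(ltW r2)// !mulr_ge0// ltW.
move=> x y m Xx Yy [_ minm].
set v := A *m x - a.
have [/enorm_eq0 v0|v0] := eqVneq (enorm v) 0.
  rewrite v0 enorm0 mulr0 addr0; apply: minm; exists x => //; split=> //.
  by apply/eqP; rewrite -subr_eq0; apply/eqP.
have vp : 0 < enorm v by rewrite lt_neqAle eq_sym v0 enorm_ge0.
have [w Aw wK] := MK (xc - x).
have AwE : A *m w = - v by rewrite Aw mulmxBr Axc /v opprB.
rewrite -Aw AwE enormN in wK.
pose D := (K + 1) * enorm v.
have D0 : 0 < D by rewrite mulr_gt0.
pose s := r / 2 / D; pose t := D / (D + r / 2).
have Dr : 0 < D + r / 2 by rewrite addr_gt0.
have s0 : 0 <= s by rewrite divr_ge0 ?ltW.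
have t01 : 0 <= t <= 1.
  by rewrite divr_ge0 ?(ltW D0) ?(ltW Dr)//= ler_pdivrMr// mul1r lerDl ltW.
have ts : t * s = 1 - t.
  rewrite /t /s mulrC mulrA divfK ?gt_eqF// -[X in X - _](divff (lt0r_neq0 Dr)) -mulrBl.
  by rewrite addrC addrK.
have Xcw : X (xc + s *: w).
  apply: rX; rewrite addrC addKr enormZ ger0_norm//.
  apply: (@le_lt_trans _ _ (s * D)).
    by rewrite ler_wpM2l// (le_trans wK)// ler_wpM2r ?enorm_ge0// lerDl.
  rewrite /s divfK ?gt_eqF//; move: r0; lra.
have Fz : feasible (t *: (xc + s *: w) + (1 - t) *: x).
  split; first by apply: (convex_set_comb (@convex_Xprod _ _ std) Xcw Xx); exact: t01.
  have -> : A *m (t *: (xc + s *: w) + (1 - t) *: x)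
     = t *: a - (t * s) *: v + (1 - t) *: (a + v).
    rewrite mulmxDr -!scalemxAr mulmxDr -scalemxAr Axc AwE scalerDr
      !scalerN scalerA.
    by congr (_ + _ *: _); rewrite /v addrC subrK.
  by rewrite ts [_ *: (a + v)]scalerDr addrACA addNr addr0
    -scalerDl [t + _]addrC subrK scale1r.
apply: le_trans (minm _ _) _; first by exists (t *: (xc + s *: w) + (1 - t) *: x).
apply: le_trans (convex_on_comb (convex_Phi cvx Yy) Xcw Xx t01) _.
have := PhiB _ _ Xcw Yy; have := PhiB _ _ Xx Yy; rewrite !ler_norml.
move=> /andP[P1 P2] /andP[P3 P4].
have tD : t <= D / (r / 2).
  by rewrite ler_pM2l// lef_pV2 ?posrE// lerDr ltW.
have E : 2 * B * (K + 1) / (r / 2) * enorm v = 2 * B * (D / (r / 2)).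
  by rewrite /D; ring.
rewrite E; case/andP: t01 => t0 t1.
have B2 : 0 <= 2 * B by rewrite mulr_ge0.
have H1 := ler_wpM2l B2 tD.
have H2 : t * Phi (xc + s *: w) y <= t * B by rewrite ler_wpM2l.
have H3 : t * (- B) <= t * Phi x y by rewrite ler_wpM2l.
move: H1 H2 H3.
move: (D / _) (Phi (xc + _) y) (Phi x y) t {E tD t1 t0 ts Fz P1 P2 P3 P4}.
move: B {PhiB B0 B2}; clear; move=> *; lra.
Qed.

End Gap.

(** A multiplier of length at most [rho] that is antiparallel to [v] turns the
    linear term into the penalty [rho * enorm v]. *)
Lemma dotv_supporting (R : realType) n (v : 'cV[R]_n) rho : 0 <= rho ->
  exists2 lt, enorm lt <= rho & - dotv lt v = rho * enorm v.
Proof.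
move=> rho0; have [/enorm_eq0 ->|v0] := eqVneq (enorm v) 0.
  by exists 0; rewrite enorm0 ?dotv0l ?mulr0 ?oppr0.
exists (- (rho / enorm v) *: v).
  by rewrite enormZ normrN ger0_norm ?divr_ge0 ?enorm_ge0// divfK.
by rewrite dotvZl mulNr opprK -enorm_sqr expr2 mulrA divfK.
Qed.

Theorem theoremB3 (R : realType) :
  exists2 c : R, 0 < c &
  forall (P : problem R) (Lx Ly : R) (mu : 'I_(nblk P) -> R) (gamma : R)
    (G : 'M[R]_(ydim P)) (H : forall i : 'I_(nblk P), 'M[R]_(xdim i)),
  (3 <= nblk P)%N ->
  standing_assumptions P ->
  convexity_assumption P Lx ->
  partial_strong_convexity_assumption mu ->
  lipschitz_assumption P Ly ->
  (forall i, posdef (H i) /\ loewner_ge (H i) (Lx + Ly)%:M) ->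
  posdef G -> loewner_ge G Ly%:M ->
  seg_gamma mu gamma ->
  (forall x y yh lam, seg_admm gamma G H x y yh lam ->
   forall (T : nat) (rho : R), (1 <= T)%N -> 0 < rho ->
     exists2 g, is_gap (ergodic x T) (ergodic yh T) g &
       g + rho * enorm (Amat P *m ergodic x T - avec P)
         <= c * (rate_numerator gamma rho G H / T%:R)) /\
  (exists2 C : R, 0 < C &
   forall x y yh lam, seg_admm gamma G H x y yh lam ->
   forall eps : R, 0 < eps <= 1 ->
     exists2 T : nat, (1 <= T)%N && (T%:R <= C / eps) &
       eps_saddle eps (ergodic x T) (ergodic yh T)).
Proof.
exists 1; first exact: ltr01.
move=> P Lx Ly mu gamma G H N3 std cvx psc lip Hpos Gpos GL gammaE.
have rate x y yh lam : seg_admm gamma G H x y yh lam ->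
   forall (T : nat) (rho : R), (1 <= T)%N -> 0 < rho ->
     exists2 g, is_gap (ergodic x T) (ergodic yh T) g &
       g + rho * enorm (Amat P *m ergodic x T - avec P)
         <= 1 * (rate_numerator gamma rho G H / T%:R).
  move=> run T rho T1 rho0.
  have Xb := ergodic_X std run T1; have Yb := ergodic_Y std run T1.
  have [v Yv vmax] := Phi_max_attained std cvx Xb.
  have [u Fu umin] := Phi_min_attained std cvx Yb.
  exists (Phi (ergodic x T) v - Phi u (ergodic yh T)).
    by exists (Phi (ergodic x T) v), (Phi u (ergodic yh T)); split.
  have [lt ltr <-] := dotv_supporting (Amat P *m ergodic x T - avec P) (ltW rho0).
  rewrite mul1r (le_trans (seg_admm_ergodic N3 std cvx psc lip Hpos Gpos GL gammaE
    run lt T1 Fu Yv))//.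
  rewrite mulrC ler_wpM2r ?invr_ge0 ?ler0n//.
  exact: (potential_init N3 std psc Hpos Gpos gammaE run).
split=> //.
have [L L0 pen] := exact_penalty std cvx.
set K := `|rate_numerator gamma (L + 1) G H|.
pose C0 := (L + 1) * (K + 1).
have C00 : 0 <= C0 by rewrite mulr_ge0 ?addr_ge0// /K.
exists (C0 + 1); first by rewrite ltr_wpDl.
move=> x y yh lam run eps /andP[eps0 eps1].
pose T := (Num.truncn (C0 / eps)).+1; exists T.
  rewrite /= /T -natr1 mulrDl mul1r lerD//; last by rewrite invf_ge1.
  by rewrite truncn_le// divr_ge0// ltW.
have T1 : (1 <= T)%N by [].
have CT : C0 / eps < T%:R := truncnS_gt _.
have T0 : 0 < T%:R :> R by rewrite ltr0n.
have Xb := ergodic_X std run T1; have Yb := ergodic_Y std run T1.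
have L1 : 0 < L + 1 by rewrite ltr_wpDl.
have [g gap gle] := rate x y yh lam run T (L + 1) T1 L1.
set e := enorm _ in gle.
have e0 : 0 <= e := enorm_ge0 _.
have gge : - (L * e) <= g.
  have [M [m [[_ Mmax] mmin ->]]] := gap.
  have := pen _ _ _ Xb Yb mmin; rewrite -/e.
  have : Phi (ergodic x T) (ergodic yh T) <= M by apply: Mmax; exists (ergodic yh T).
  lra.
have KT : rate_numerator gamma (L + 1) G H / T%:R <= K / T%:R.
  by rewrite ler_wpM2r ?invr_ge0 ?ler0n// ler_norm.
have CT' : (L + 1) * (K / T%:R) <= eps.
  rewrite mulrA ler_pdivrMr//; move: CT; rewrite ltr_pdivrMr// => CT.
  rewrite mulrC in CT; apply: le_trans (ltW CT).
  by rewrite ler_wpM2l ?(ltW L1)// lerDl.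
have KT0 : 0 <= K / T%:R by rewrite divr_ge0 ?ler0n// /K.
have H1 := mulr_ge0 L0 KT0.
have H2 := mulr_ge0 L0 e0.
rewrite mul1r in gle.
have eK : e <= K / T%:R by lra.
have LeK := ler_wpM2l L0 eK.
split=> //; last by rewrite -/e; lra.
by exists g => //; apply/andP; split; lra.
Qed.
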